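(* Let $d\ge 2$ and $c>0$ be constants, $n$ prime, $m=cn$, and $\delta=n^{-0.01}$. Consider the following coupled algorithm starting from an empty table of $n$ bins. It attempts to throw $(1+2\delta)m$ balls. Before each ball, if some bin $z$ (being $j$th in the current ordering) has $\eta(z)>(1+\delta)p_j$, the algorithm fails and stops. Otherwise, with probability $1/(1+\delta)$ the ball is placed according to double hashing (a ''double hashing ball''); with the remaining probability $\delta/(1+\delta)$ the ball is placed into each bin $z$, $z$ being $j$th in the ordering, with probability $\delta^{-1}\left((1+\delta)p_j-\eta(z)\right)$ (an ''extra ball''). Then with high probability (as $n\to\infty$) the algorithm does not fail, so that all $(1+2\delta)m$ balls are placed with the distribution of modified random hashing, and at least $m$ of the balls are double hashing balls. Consequently, with high probability, the final bin state dominates the bin state obtained by placing $m$ balls using double hashing.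
   Context: There are $n$ bins; a bin state records the number of balls in each bin. State $B=(b_i)$ dominates $A=(a_i)$ if $b_i\ge a_i$ for all $i$. Ties are broken as follows: at each step a uniformly random ranking (permutation of $[1,n]$), independent across steps, is drawn, and bins are totally ordered first by load and then by rank; the $1$st ordered bin is the most loaded bin with lowest tie-breaking priority and the $n$th is the least loaded with highest priority; a ball always goes to the candidate latest in this ordering. Modified random hashing: with probability $n^{-0.4}$ the ball goes to a uniformly random bin; otherwise to the least loaded of $d$ distinct uniformly random bins. Under it the $j$th ordered bin gets the next ball with probability $p_j=(1-n^{-0.4})\frac{d}{n}\binom{j-1}{d-1}/\binom{n-1}{d-1}+n^{-1.4}$. Double hashing: a hash pair $(f,g)$, $f$ uniform in $\{0,\dots,n-1\}$, $g$ uniform in $\{1,\dots,n-1\}$, gives candidates $(f+kg)\bmod n$, $k=0,\dots,d-1$, and the ball goes to the least loaded candidate (by the ordering). For the current state, $\eta(z)$ is the probability that bin $z$ receives the next ball under double hashing, i.e. the number of the $n(n-1)$ hash pairs that would send the ball to $z$, divided by $n(n-1)$. *)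

(* Defs.v *)
From mathcomp Require Import all_boot all_order all_algebra all_fingroup.
From mathcomp Require Import reals exp.

Set Implicit Arguments.
Unset Strict Implicit.
Unset Printing Implicit Defensive.
Import Order.TTheory GRing.Theory Num.Theory.
Local Open Scope ring_scope.

Section FiniteProbability.
Variable R : realType.

Definition Pr (A : finType) (P : A -> R) (E : pred A) : R := \sum_(a | E a) P a.

(* [K h o] is the conditional probability that the next step has outcome [o],
   given the list [h] of the outcomes of all the previous steps in order. *)
Definition trajectory_law (A : finType) (K : seq A -> A -> R) (T : nat)
    (w : T.-tuple A) : R :=
  \prod_(t < T) K (take t w) (tnth w t).

Definition is_coupling (A B : finType) (P : A -> R) (Q : B -> R)
    (J : A * B -> R) : Prop :=
  [/\ forall x, 0 <= J x,
      forall a, \sum_b J (a, b) = P a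
    & forall b, \sum_a J (a, b) = Q b].

(* [k] is [x] rounded to an integer, either up or down. *)
Definition rounds_to (x : R) (k : nat) : bool :=
  Num.floor x <= k%:Z <= Num.ceil x.

End FiniteProbability.

Section Bins.
Variable n : nat.

Definition bin_state := {ffun 'I_n -> nat}.

Definition dominates (B A : bin_state) : bool :=
  [forall i, (A i <= B i)%N].

Definition loads (placed : seq 'I_n) : bin_state :=
  [ffun z => count_mem z placed].

(* Strict total order of the bins: the most loaded bins come first and, among
   bins of equal load, those with the smallest rank [r] (the lowest
   tie-breaking priority) come first. *)
Definition before (s : bin_state) (r : 'S_n) (x y : 'I_n) : bool :=
  (s y < s x)%N || ((s x == s y) && (r x < r y)%N).

(* The [j], counted from 1, such that [z] is the [j]th ordered bin. *)
Definition position (s : bin_state) (r : 'S_n) (z : 'I_n) : nat :=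
  #|[set x | before s r x z]|.+1.

(* A ball with set of candidates [C] goes to [z]. *)
Definition goes_to (s : bin_state) (r : 'S_n) (C : {set 'I_n}) (z : 'I_n) :
    bool :=
  (z \in C) && [forall x in C, (x == z) || before s r x z].

(* [(f, g)] encodes the hash pair with offset [f] and stride [g.+1], so that
   strides range over 1, ..., n-1. *)
Definition hash_pair : finType := ('I_n * 'I_n.-1)%type.

Definition candidates (d : nat) (h : hash_pair) : {set 'I_n} :=
  [set z : 'I_n | [exists k : 'I_d, (z : nat) == ((h.1 + k * h.2.+1) %% n)%N]].

End Bins.

Section Processes.
Variables (R : realType) (d n : nat).

Definition delta : R := n%:R `^ (- (1 / 100)).

Definition eta (s : bin_state n) (r : 'S_n) (z : 'I_n) : R :=
  #|[set h : hash_pair n | goes_to s r (candidates d h) z]|%:R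
    / (n * n.-1)%:R.

Definition next_prob (j : nat) : R :=
  (1 - n%:R `^ (- (4 / 10)))
    * (d%:R / n%:R) * ('C(j.-1, d.-1)%:R / 'C(n.-1, d.-1)%:R)
  + n%:R `^ (- (14 / 10)).

(* Probability that bin [z] receives the next ball under modified random
   hashing, from the mechanism itself rather than the formula [next_prob]. *)
Definition mrh_prob (s : bin_state n) (r : 'S_n) (z : 'I_n) : R :=
  n%:R `^ (- (4 / 10)) * (1 / n%:R)
  + (1 - n%:R `^ (- (4 / 10)))
    * (#|[set C : {set 'I_n} | (#|C| == d) && goes_to s r C z]|%:R
        / 'C(n, d)%:R).

(* One step of an allocation process: the ranking drawn at that step and the
   bin which receives the ball. *)
Definition step : finType := ('S_n * 'I_n)%type.

Definition final_state (w : seq step) : bin_state n := loads (map snd w).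

Definition dh_kernel (h : seq step) (o : step) : R :=
  (n`!%:R)^-1 * eta (final_state h) o.1 o.2.

Definition mrh_kernel (h : seq step) (o : step) : R :=
  (n`!%:R)^-1 * mrh_prob (final_state h) o.1 o.2.

(* One step of the coupled algorithm: the ranking, and either [Some (b, z)]
   when a ball is placed in bin [z], as a double hashing ball if [b] is true
   and as an extra ball otherwise, or [None] when the algorithm fails at this
   step or has failed before.  (Rankings drawn after a failure play no role;
   they only make all trajectories have the same length.) *)
Definition cstep : finType := ('S_n * option (bool * 'I_n))%type.

Definition placed (h : seq cstep) : seq 'I_n :=
  pmap (fun o : cstep => omap snd o.2) h.

Definition cfinal_state (h : seq cstep) : bin_state n := loads (placed h).

Definition failed (h : seq cstep) : bool :=
  has (fun o : cstep => o.2 == None) h.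

Definition dh_balls (h : seq cstep) : nat :=
  count (fun o : cstep => if o.2 is Some (b, _) then b else false) h.

Definition failure_test (s : bin_state n) (r : 'S_n) : bool :=
  [exists z, (1 + delta) * next_prob (position s r z) < eta s r z].

Definition coupled_kernel (h : seq cstep) (o : cstep) : R :=
  let s := cfinal_state h in
  let r := o.1 in
  let stop := failed h || failure_test s r in
  (n`!%:R)^-1 *
  match o.2 with
  | None => if stop then 1 else 0
  | Some (b, z) =>
      if stop then 0
      else if b then 1 / (1 + delta) * eta s r z
      else delta / (1 + delta)
           * (delta^-1 * ((1 + delta) * next_prob (position s r z) - eta s r z))
  end.

Definition dh_law (T : nat) : T.-tuple step -> R :=
  @trajectory_law R step dh_kernel T.

Definition mrh_law (T : nat) : T.-tuple step -> R :=
  @trajectory_law R step mrh_kernel T.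

Definition coupled_law (T : nat) : T.-tuple cstep -> R :=
  @trajectory_law R cstep coupled_kernel T.

(* The coupled trajectory [u] draws the rankings of [w] and places, without
   failing, all the balls of [w] in the same bins. *)
Definition places_as (w : seq step) (u : seq cstep) : bool :=
  map (fun o : cstep => (o.1, omap snd o.2)) u
    == map (fun o : step => (o.1, Some o.2)) w.

(* The failure test succeeds at no step along [w]. *)
Definition never_fails (T : nat) (w : T.-tuple step) : bool :=
  [forall t : 'I_T,
     ~~ failure_test (final_state (take t w)) (tnth w t).1].

End Processes.

(* Main.v *)
(** By symmetry, under modified random hashing the ordering of the bins at each
    step is uniformly random.  For a uniformly random ordering the expected
    number of hash pairs that send the ball to the [j]th bin is exactly the one
    given by random [d]-subsets, and, once that bin is fixed, exchanging two
    other bins changes the number by at most [2 d ^ 2], because two terms of a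
    progression modulo a prime determine it.  A martingale argument on the
    symmetric group gives a deviation below [n ^ 0.6] except with probability
    [exp (- Omega (n ^ 0.2))], so a union bound over bins and steps excludes
    failure.  As long as the algorithm does not fail it places balls exactly as
    modified random hashing does, which transfers the bound to it.  The extra
    balls are handled by an exponential moment, and domination by running both
    processes with the same rankings and hash pairs. *)

Require Import Defs.
From mathcomp Require Import all_boot all_order all_algebra all_fingroup.
From mathcomp Require Import reals exp.
From mathcomp Require Import sequences ring lra zify.
Set Implicit Arguments.
Unset Strict Implicit.
Unset Printing Implicit Defensive.
Import Order.TTheory GRing.Theory Num.Theory.
Local Open Scope ring_scope.

(** * Laws of trajectories *)

Section TupleSums.
Variables (R : realType) (A : finType).

Lemma sum_tuple0 (P : pred (seq A)) (F : seq A -> R) :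
  \sum_(w : 0.-tuple A | P w) F w = if P [::] then F [::] else 0.
Proof.
rewrite big_mkcond (big_pred1 [tuple]) // => w.
by apply/esym/eqP; exact: tuple0.
Qed.

Lemma sum_tupleS T (P : pred (seq A)) (F : seq A -> R) :
  \sum_(w : T.+1.-tuple A | P w) F w
    = \sum_a \sum_(w : T.-tuple A | P (a :: w)) F (a :: w).
Proof.
rewrite pair_big_dep /=.
rewrite (reindex (fun p : A * T.-tuple A => cons_tuple p.1 p.2)) //=.
exists (fun w : T.+1.-tuple A => (thead w, behead_tuple w)).
  by case=> a w _ /=; congr pair; apply/val_inj.
by move=> w _; rewrite [w]tuple_eta; apply/val_inj.
Qed.

End TupleSums.

Section TrajectoryLaws.
Variables (R : realType) (A : finType).
Implicit Types K : seq A -> A -> R.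

(** The past [h] is an explicit argument so that inductions over the remaining outcomes [w] can vary
    it. *)
Fixpoint law_from K (h w : seq A) : R :=
  if w is o :: w' then K h o * law_from K (rcons h o) w' else 1.

Lemma trajectory_lawE K T (w : T.-tuple A) :
  trajectory_law K w = law_from K [::] w.
Proof.
rewrite /trajectory_law.
have gen h (s : seq A) n (a : A) : size s = n ->
    \prod_(t < n) K (h ++ take t s) (nth a s t) = law_from K h s.
  elim: s n h => [|o s IH] [|n] h //= => [_|[sz]]; first by rewrite big_ord0.
  rewrite big_ord_recl /= cats0 -(IH n) //; congr (_ * _).
  by apply: eq_bigr => i _; rewrite /= cat_rcons.
(* [nth] needs a default outcome, and only a nonempty tuple supplies one. *)
case: T w => [|T] w; first by rewrite big_ord0 [w]tuple0.
rewrite -(gen [::] w _ (thead w) (size_tuple w)); apply: eq_bigr => t _.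
by rewrite (tnth_nth (thead w)).
Qed.

Lemma law_from_ge0 K h w : (forall h o, 0 <= K h o) -> 0 <= law_from K h w.
Proof. by move=> K0; elim: w h => //= o w IH h; rewrite mulr_ge0. Qed.

Lemma law_from_total K T h : (forall h, \sum_o K h o = 1) ->
  \sum_(w : T.-tuple A) law_from K h w = 1.
Proof.
move=> K1; elim: T h => [|T IH] h.
  exact: (sum_tuple0 predT (law_from K h)).
rewrite (sum_tupleS _ predT) /= -[RHS](K1 h); apply: eq_bigr => o _.
by rewrite -mulr_sumr IH mulr1.
Qed.

(** Conditionally on any past, one more factor [g] multiplies the expectation by at most [B]. This
    gives the exponential moment for the number of extra balls. *)
Lemma law_from_product_bound K (g : A -> R) (B : R) T h :
    (forall h o, 0 <= K h o) -> (forall h, \sum_o K h o * g o <= B) ->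
    (forall o, 0 <= g o) ->
  \sum_(w : T.-tuple A) law_from K h w * \prod_(o <- w) g o <= B ^+ T.
Proof.
move=> K0 KB g0.
have B0 : 0 <= B.
  by apply: le_trans (KB [::]); apply: sumr_ge0 => o _; rewrite mulr_ge0.
elim: T h => [|T IH] h.
  rewrite (sum_tuple0 predT (fun w => law_from K h w * \prod_(o <- w) g o)) /=.
  by rewrite big_nil mulr1 expr0.
rewrite (sum_tupleS _ predT (fun w => law_from K h w * \prod_(o <- w) g o)) /=.
rewrite exprS; apply: le_trans (ler_wpM2r (exprn_ge0 T B0) (KB h)).
rewrite mulr_suml; apply: ler_sum => o _.
under eq_bigr => w _ do rewrite big_cons mulrACA.
by rewrite -mulr_sumr ler_wpM2l ?mulr_ge0.
Qed.

Lemma law_from_map K (f : A -> A) :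
    (forall h o, K (map f h) (f o) = K h o) ->
  forall h w, law_from K (map f h) (map f w) = law_from K h w.
Proof.
move=> Kf h w; elim: w h => //= o w IH h.
by rewrite Kf -map_rcons IH.
Qed.

End TrajectoryLaws.

(** * Concentration on the symmetric group *)

Section PermConcentration.
Variable R : realType.

(** Multiplying by [1 - x > 0] reduces this to [expR x * (1 - x) <= 1], since the right side becomes
    [1 + x ^+ 2 * (1 - 2 * x) >= 1]. *)
Lemma expR_le_quad (x : R) : x <= 1 / 2 -> expR x <= 1 + x + 2 * x ^+ 2.
Proof.
move=> x2; have e1 := expR_ge1Dx (- x).
have : expR x * (1 - x) <= 1.
  by rewrite -[leRHS](expRxMexpNx_1 x) ler_wpM2l ?expR_ge0.
have e0 := expR_gt0 x.
move=> h.
have : (1 - x) * expR x <= (1 - x) * (1 + x + 2 * x ^+ 2).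
  rewrite mulrC; apply: le_trans h _.
  have -> : (1 - x) * (1 + x + 2 * x ^+ 2) = 1 + x ^+ 2 * (1 - 2 * x) by ring.
  by rewrite lerDl mulr_ge0 ?sqr_ge0//; lra.
by rewrite ler_pM2l //; lra.
Qed.

(** A Hoeffding-type bound: the linear terms of [expR_le_quad] cancel because [Y] sums to zero. *)
Lemma mgf_bounded_centered (I : finType) (Y : I -> R) (L lam : R) :
    (forall i, `|Y i| <= L) -> \sum_i Y i = 0 -> 0 <= lam -> lam * L <= 1 / 2 ->
  \sum_i expR (lam * Y i) <= #|I|%:R * expR (2 * (lam * L) ^+ 2).
Proof.
move=> YL Y0 lam0 lamL.
have b i : expR (lam * Y i) <= 1 + lam * Y i + 2 * (lam * L) ^+ 2.
  have h : `|lam * Y i| <= lam * L by rewrite normrM ger0_norm // ler_wpM2l.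
  apply: le_trans (expR_le_quad _) _.
    by apply: le_trans lamL; apply: le_trans h; apply: ler_norm.
  rewrite lerD2l ler_pM2l // -(real_normK (num_real (lam * Y i))).
  by rewrite ler_pXn2r ?nnegrE //; apply: le_trans h.
apply: le_trans (ler_sum _ (fun i _ => b i)) _.
rewrite big_split /= big_split /= -mulr_sumr Y0 mulr0 addr0 !sumr_const.
by rewrite -mulrnDl -[X in X <= _]mulr_natl ler_wpM2l // expR_ge1Dx.
Qed.

(** For fixed [j], [lift_perm i j s] runs exactly once over the permutations sending [i] to [j], so
    this conditions a uniform permutation on its value at [i]. *)
Lemma sum_lift_perm N (i : 'I_N.+1) (F : 'S_N.+1 -> R) :
  \sum_s F s = \sum_j \sum_(s : 'S_N) F (lift_perm i j s).
Proof.
rewrite pair_big /=.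
pose g (p : 'I_N.+1 * 'S_N) := lift_perm i p.1 p.2.
have g_inj : injective g.
  move=> [j s] [j' s'] /= e.
  have ej : j = j' by move/(congr1 (fun u : 'S__ => u i)): e; rewrite /g /= !lift_perm_id.
  subst j'; congr pair; apply/permP => k.
  move/(congr1 (fun u : 'S__ => u (lift i k))): e; rewrite /g /= !lift_perm_lift.
  exact: lift_inj.
rewrite (reindex g) //; apply/onW_bij/inj_card_bij => //.
by rewrite card_prod !card_Sn card_ord factS.
Qed.

Lemma lift_permMtperm N (i j : 'I_N.+1) (s : 'S_N) a b :
  (lift_perm i j (s * tperm a b) = lift_perm i j s * tperm (lift j a) (lift j b))%g.
Proof.
apply/permP => k; rewrite permM; case: (unliftP i k) => [k'|] ->.
  rewrite !lift_perm_lift permM.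
  by rewrite !permE /= !(inj_eq lift_inj); case: ifP; last case: ifP.
by rewrite !lift_perm_id tpermD // eq_sym neq_lift.
Qed.

(** Products act from left to right, so multiplying by [t] on the right carries the permutations
    sending [i] to [k] onto those sending [i] to [t k]. *)
Lemma sum_perm_fiber N (i k : 'I_N.+1) (t : 'S_N.+1) (F : 'S_N.+1 -> R) :
  \sum_(s : 'S_N) F (lift_perm i (t k) s)
    = \sum_(s : 'S_N) F (lift_perm i k s * t)%g.
Proof.
have fiber l (G : 'S_N.+1 -> R) :
    \sum_(s : 'S_N) G (lift_perm i l s) = \sum_(s : 'S_N.+1 | s i == l) G s.
  rewrite [RHS]big_mkcond (sum_lift_perm i) (bigD1 l) //=.
  rewrite [X in _ = _ + X]big1 ?addr0 => [|m /negPf ml].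
    by apply: eq_bigr => s _; rewrite lift_perm_id eqxx.
  by rewrite big1 // => s _; rewrite lift_perm_id ml.
rewrite (fiber (t k)) (fiber k (fun s => F (s * t)%g)).
rewrite (reindex_inj (mulIg t)) /=; apply: eq_bigl => s.
by rewrite permM (inj_eq perm_inj).
Qed.

(** Induction that reveals the image of one point at a time. The conditional means [m j] average to
    [mu] and lie within [L] of each other, so each revelation costs a factor
    [expR (2 * (lam * L) ^+ 2)]. *)
Lemma perm_mgf_bound N (F : 'S_N -> R) (L lam mu : R) :
    (forall s a b, `|F (s * tperm a b)%g - F s| <= L) ->
    \sum_s F s = N`!%:R * mu -> 0 <= lam -> lam * L <= 1 / 2 ->
  \sum_s expR (lam * (F s - mu)) <= N`!%:R * expR (2 * (lam * L) ^+ 2 * N%:R).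
Proof.
move=> + + lam0 lamL; elim: N F mu => [|N IH] F mu FL Fmu.
  have e s : F s = mu.
    have S0 (t : 'S_0) : t = 1%g by apply/permP; case.
    by rewrite -[RHS]mul1r -[1 * mu]Fmu (big_pred1 s) // => t;
      rewrite /= (S0 t) (S0 s) eqxx.
  under eq_bigr => s _ do rewrite e subrr mulr0 expR0.
  by rewrite sumr_const card_Sn fact0 mulr0 expR0 mul1r.
have fN0 : (N`!%:R : R) != 0 by rewrite pnatr_eq0 -lt0n fact_gt0.
pose m j : R := (\sum_(s : 'S_N) F (lift_perm ord0 j s)) / N`!%:R.
have mE j : \sum_(s : 'S_N) F (lift_perm ord0 j s) = N`!%:R * m j.
  by rewrite /m mulrC divfK.
have msum : \sum_j m j = N.+1%:R * mu.
  apply: (mulfI fN0); rewrite mulr_sumr.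
  under eq_bigr => j _ do rewrite -mE.
  by rewrite -sum_lift_perm Fmu factS natrM; ring.
have mdiff j k : `|m j - m k| <= L.
  rewrite -(ler_pM2l (_ : 0 < N`!%:R)) ?ltr0n ?fact_gt0 //.
  rewrite -{1}[N`!%:R]ger0_norm ?ler0n // -normrM mulrBr -!mE.
  (* [tperm k j] matches the fibre over [k] with the fibre over [j], and matched permutations differ
     by one transposition. *)
  rewrite -{1}(tpermL k j) sum_perm_fiber -sumrB.
  apply: le_trans (ler_norm_sum _ _ _) _.
  apply: le_trans (ler_sum _ (fun s _ => FL _ _ _)) _.
  by rewrite sumr_const card_Sn mulr_natl.
have mL j : `|m j - mu| <= L.
  rewrite -(ler_pM2l (_ : 0 < N.+1%:R)) ?ltr0n //.
  rewrite -{1}[N.+1%:R]ger0_norm ?ler0n // -normrM mulrBr -msum.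
  have -> : N.+1%:R * m j = \sum_(k < N.+1) m j.
    by rewrite sumr_const card_ord mulr_natl.
  rewrite -sumrB.
  apply: le_trans (ler_norm_sum _ _ _) _.
  apply: le_trans (ler_sum _ (fun k _ => mdiff _ _)) _.
  by rewrite sumr_const card_ord mulr_natl.
rewrite (sum_lift_perm ord0).
pose B : R := N`!%:R * expR (2 * (lam * L) ^+ 2 * N%:R).
have B0 : 0 <= B by rewrite mulr_ge0 ?expR_ge0.
apply: (@le_trans _ _ (\sum_j expR (lam * (m j - mu)) * B)).
  apply: ler_sum => j _.
  have factor s : expR (lam * (F (lift_perm ord0 j s) - mu))
      = expR (lam * (m j - mu)) * expR (lam * (F (lift_perm ord0 j s) - m j)).
    by rewrite -expRD; congr expR; ring.
  under eq_bigr => s _ do rewrite factor.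
  rewrite -mulr_sumr ler_wpM2l ?expR_ge0 //.
  apply: IH => // s a b; rewrite lift_permMtperm; exact: FL.
rewrite -mulr_suml.
have sum0 : \sum_j (m j - mu) = 0.
  by rewrite sumrB msum sumr_const card_ord mulr_natl subrr.
apply: le_trans (ler_wpM2r B0 (mgf_bounded_centered mL sum0 lam0 lamL)) _.
rewrite card_ord /B factS natrM.
have -> : 2 * (lam * L) ^+ 2 * N.+1%:R
    = 2 * (lam * L) ^+ 2 + 2 * (lam * L) ^+ 2 * N%:R :> R.
  by rewrite -natr1; ring.
by rewrite expRD; lra.
Qed.

(** Markov's inequality for the exponential moment; [lam] stays free and is chosen in
    [failure_tail]. *)
Lemma perm_concentration N (F : 'S_N -> R) (L lam mu t : R) :
    (forall s a b, `|F (s * tperm a b)%g - F s| <= L) ->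
    \sum_s F s = N`!%:R * mu -> 0 <= lam -> lam * L <= 1 / 2 ->
  #|[set s | mu + t < F s]|%:R
    <= N`!%:R * expR (2 * (lam * L) ^+ 2 * N%:R - lam * t).
Proof.
move=> FL Fmu lam0 lamL; rewrite expRD mulrA.
rewrite -ler_pdivrMr ?expR_gt0 // -expRN opprK.
apply: le_trans (perm_mgf_bound FL Fmu lam0 lamL).
rewrite -sum1_card natr_sum mulr_suml big_mkcond /=.
apply: ler_sum => s _; rewrite inE; case: ifP => [h|_]; last exact: expR_ge0.
by rewrite mul1r ler_expR ler_wpM2l //; lra.
Qed.

End PermConcentration.

(** * The ordering of the bins *)

Section BinOrder.
Variable n : nat.
Implicit Types (s : bin_state n) (r : 'S_n) (C D : {set 'I_n}) (x y z : 'I_n).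

(** The lexicographic order as one number in base [n]: the load leads and the reversed rank is the
    last digit. Later bins have smaller keys. *)
Definition bin_key s r x : nat := (s x * n + (n.-1 - r x))%N.

Lemma before_key s r x y : before s r x y = (bin_key s r y < bin_key s r x)%N.
Proof.
rewrite /before /bin_key; have := ltn_ord (r x); have := ltn_ord (r y).
move: (r x : nat) (r y : nat) => a b; case: (ltngtP (s x) (s y)) => /= [h|h|->].
- by nia.
- by nia.
- by lia.
Qed.

Lemma bin_key_inj s r : injective (bin_key s r).
Proof.
move=> x y e; apply: (@perm_inj _ r); apply/val_inj => /=.
have := ltn_ord (r x); have := ltn_ord (r y); move: e; rewrite /bin_key.
by move: (r x : nat) (r y : nat) => a b; case: (ltngtP (s x) (s y)) => ?; nia.
Qed.

Lemma goes_to_unique s r C : C != set0 ->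
  exists z0, forall z, goes_to s r C z = (z == z0).
Proof.
case/set0Pn => x0 x0C; case: (arg_minnP (bin_key s r) x0C) => z0 z0C z0min.
exists z0 => z; apply/andP/eqP => [[zC /forall_inP zb]|->].
  have := zb _ z0C; rewrite before_key => /orP[/eqP->//|].
  by rewrite ltnNge z0min.
split=> //; apply/forall_inP => x xC; have := z0min _ xC.
by rewrite before_key leq_eqVlt => /orP[/eqP/bin_key_inj->|->]; rewrite ?eqxx ?orbT.
Qed.

Lemma card_goes_to_sum s r (I : finType) (A : {set I}) (C : I -> {set 'I_n}) :
    (forall i, i \in A -> C i != set0) ->
  (\sum_z #|[set i in A | goes_to s r (C i) z]|)%N = #|A|.
Proof.
move=> C0; under eq_bigr => z _ do rewrite -sum1_card big_mkcond /=.
rewrite exchange_big -sum1_card [RHS]big_mkcond /=; apply: eq_bigr => i _.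
under eq_bigr => z _ do rewrite inE.
case: (boolP (i \in A)) => [iA|_]; last by rewrite big1.
have [z0 z0E] := goes_to_unique s r (C0 i iA).
by rewrite (bigD1 z0) //= z0E eqxx big1 // => z /negPf zz0; rewrite z0E zz0.
Qed.

(** The sets whose ball goes to [z] consist of [z] and [d.-1] of the [(position s r z).-1] bins
    before it. *)
Lemma card_goes_to s r d z : (0 < d)%N ->
  #|[set C : {set 'I_n} | (#|C| == d) && goes_to s r C z]|
    = 'C((position s r z).-1, d.-1).
Proof.
move=> d0; rewrite /position /=; set S := [set x | before s r x z].
have zS : z \notin S by rewrite inE before_key ltnn.
rewrite -cards_draws.
rewrite -[RHS](card_in_imset (f := fun D => z |: D)); last first.
  move=> D D'; rewrite !inE => /andP[DS _] /andP[D'S _] e.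
  have zD (E : {set 'I_n}) : E \subset S -> z \notin E by move=> ES; apply: contra zS => /(subsetP ES).
  by rewrite -(setU1K (zD _ DS)) e setU1K // zD.
congr (#|pred_of_set _|); apply/setP => C; rewrite inE.
apply/idP/imsetP => [/andP[/eqP Cd /andP[zC /forall_inP Cb]]|[D]].
  exists (C :\ z); last by rewrite setD1K.
  rewrite inE; apply/andP; split; last by rewrite -Cd (cardsD1 z C) zC.
  apply/subsetP => x; rewrite !inE => /andP[/negPf xz xC].
  by have := Cb _ xC; rewrite xz.
rewrite inE => /andP[DS /eqP Dd ->].
have zD : z \notin D by apply: contra zS => /(subsetP DS).
rewrite cardsU1 zD Dd add1n prednK // eqxx /goes_to setU11 /=.
apply/forall_inP => x; rewrite !inE => /orP[->//|/(subsetP DS)].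
by rewrite inE => ->; rewrite orbT.
Qed.

(** List each set followed by its complement and match the two lists entry by entry; equal
    cardinalities make the sets correspond. *)
Lemma exists_perm_preimset C D : #|C| = #|D| ->
  exists t : 'S_n, t @^-1: C = D.
Proof.
move=> eCD; pose e (A : {set 'I_n}) := enum A ++ enum (~: A).
have e_uniq A : uniq (e A).
  rewrite cat_uniq !enum_uniq andbT /=; apply/hasPn => x.
  by rewrite !mem_enum inE.
have e_mem A x : x \in e A by rewrite mem_cat !mem_enum inE orbN.
have e_size A : size (e A) = n.
  by rewrite size_cat -!cardE cardsC card_ord.
have idx x : (index x (e D) < size (e C))%N.
  by have := e_mem D x; rewrite -index_mem !e_size.
pose t x := nth x (e C) (index x (e D)).
have t_inj : injective t.
  move=> x y; rewrite /t (set_nth_default x y) // => /eqP.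
  rewrite nth_uniq // => /eqP h.
  by rewrite -(nth_index x (e_mem D x)) h nth_index.
exists (perm t_inj); apply/setP => x; rewrite inE permE /t.
have -> : (x \in D) = (index x (e D) < #|D|)%N.
  by rewrite index_cat cardE mem_enum; case: ifP => xD;
    [rewrite index_mem mem_enum | rewrite ltnNge leq_addr].
rewrite nth_cat -cardE eCD; case: ifP => h.
  by rewrite -mem_enum mem_nth // -cardE eCD.
have : nth x (enum (~: C)) (index x (e D) - #|D|) \in enum (~: C).
  rewrite mem_nth // -cardE ltn_subLR; last by rewrite leqNgt h.
  by rewrite -eCD cardsC card_ord; have := idx x; rewrite (e_size C).
by rewrite mem_enum inE => /negPf.
Qed.

End BinOrder.

(** * Relabelling the bins *)

Section Relabelling.
Variable n : nat.
Implicit Types (s : bin_state n) (r : 'S_n) (C D : {set 'I_n}) (x y z : 'I_n).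

(** Bin [x] becomes bin [t x]; the matching ranking is [t^-1 * r], which gives [t x] the old rank of
    [x]. *)
Definition relabel (t : 'S_n) s : bin_state n := [ffun x => s (t^-1 x)%g].

Lemma before_relabel (t : 'S_n) s r x y :
  before (relabel t s) (t^-1 * r)%g (t x) (t y) = before s r x y.
Proof. by rewrite /before !ffunE !permM !permK. Qed.

Lemma goes_to_relabel (t : 'S_n) s r C z :
  goes_to (relabel t s) (t^-1 * r)%g C (t z) = goes_to s r (t @^-1: C) z.
Proof.
rewrite /goes_to inE; congr (_ && _); apply/forall_inP/forall_inP => h x.
  by rewrite inE => /h; rewrite before_relabel (inj_eq perm_inj).
move=> xC; have := h (t^-1 x)%g; rewrite inE permKV => /(_ xC).
by rewrite -(before_relabel t) -(inj_eq (@perm_inj _ t)) permKV.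
Qed.

Lemma position_relabel (t : 'S_n) s r z :
  position (relabel t s) (t^-1 * r)%g (t z) = position s r z.
Proof.
rewrite /position; congr _.+1; rewrite -[RHS](card_imset _ (@perm_inj _ t)).
congr #|pred_of_set _|; apply/setP => x; rewrite inE.
apply/idP/imsetP => [h|[y]]; last by rewrite inE => h ->; rewrite before_relabel.
by exists (t^-1 x)%g; rewrite ?permKV // inE -(before_relabel t) permKV.
Qed.

Lemma card_preimset_perm (t : 'S_n) C : #|t @^-1: C| = #|C|.
Proof.
rewrite -[LHS](card_imset _ (@perm_inj _ t)); congr #|pred_of_set _|.
apply/setP => x; apply/imsetP/idP => [[y]|xC]; first by rewrite inE => ? ->.
by exists (t^-1 x)%g; rewrite ?inE permKV.
Qed.

Lemma preimset_permM (t u : 'S_n) C : (t * u)%g @^-1: C = t @^-1: (u @^-1: C).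
Proof. by apply/setP => x; rewrite !inE permM. Qed.

Lemma card_goes_to_relabel (t : 'S_n) d s r z :
  #|[set C : {set 'I_n} | (#|C| == d)
                          && goes_to (relabel t s) (t^-1 * r)%g C (t z)]|
    = #|[set C : {set 'I_n} | (#|C| == d) && goes_to s r C z]|.
Proof.
rewrite -[LHS](card_in_imset (f := fun C : {set 'I_n} => t @^-1: C)); last first.
  move=> C D _ _ /(congr1 (fun E : {set 'I_n} => (t^-1)%g @^-1: E)).
  rewrite -!preimset_permM mulVg.
  by move=> /setP e; apply/setP => x; have := e x; rewrite !inE perm1.
congr #|pred_of_set _|; apply/setP => C.
have CK : t @^-1: ((t^-1)%g @^-1: C) = C.
  by rewrite -preimset_permM mulgV; apply/setP => x; rewrite inE perm1.
apply/imsetP/idP => [[D]|]; rewrite !inE.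
  by rewrite goes_to_relabel => /andP[Dd h] ->; rewrite card_preimset_perm Dd.
move=> /andP[Cd h]; exists ((t^-1)%g @^-1: C) => //.
by rewrite inE goes_to_relabel card_preimset_perm Cd CK.
Qed.

(* All sets of size [#|C|] are equally likely to be the preimage of [C] under a
   uniformly random [t], so counting over [t] is counting over such sets. *)
Lemma card_perm_goes_to s r C z : (0 < #|C|)%N ->
  ('C(n, #|C|) * #|[set t : 'S_n | goes_to s r (t @^-1: C) z]|
    = n`! * 'C((position s r z).-1, #|C|.-1))%N.
Proof.
move=> C0; pose M D := #|[set t : 'S_n | goes_to s r (t @^-1: D) z]|.
have MC D : #|D| = #|C| -> M D = M C.
  move=> /esym e; have [u <-] := exists_perm_preimset e; rewrite /M.
  rewrite -[RHS](card_preimset _ (mulIg u)).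
  by congr #|pred_of_set _|; apply/setP => t; rewrite !inE preimset_permM.
have -> : ('C(n, #|C|) * M C = \sum_(D : {set 'I_n} | #|D| == #|C|) M D)%N.
  rewrite (eq_bigr (fun _ => M C)) => [|D /eqP/MC//].
  rewrite sum_nat_const; congr (_ * _)%N.
  by rewrite -[RHS]cardsE card_draws card_ord.
under eq_bigr => D _ do rewrite /M -sum1_card big_mkcond /=.
rewrite exchange_big /= -card_Sn -sum_nat_const; apply: eq_bigr => t _.
rewrite -(card_goes_to s r z C0) -(card_goes_to_relabel t) -sum1_card.
rewrite -big_mkcondr /=; apply: eq_bigl => D.
by rewrite !inE goes_to_relabel.
Qed.

End Relabelling.

(** * Arithmetic progressions modulo a prime *)

Section Progressions.
Variable p : nat.
Hypothesis p_pr : prime p.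

Lemma eqn_mod_Fp a b : (a == b %[mod p])%N = (a%:R == b%:R :> 'F_p).
Proof. by rewrite -val_eqE /= !val_Fp_nat. Qed.

Lemma eq_Fp_small a b : (a < p)%N -> (b < p)%N -> (a%:R == b%:R :> 'F_p) = (a == b).
Proof. by move=> ap bp; rewrite -eqn_mod_Fp !modn_small. Qed.

(** Subtracting the two congruences gives [(k - l) * (g - g') = 0] in the field ['F_p], where
    [k - l] is nonzero. *)
Lemma two_terms_determine_progression f f' g g' k l :
    (k < p)%N -> (l < p)%N -> k != l ->
    (f < p)%N -> (f' < p)%N -> (g < p)%N -> (g' < p)%N ->
    f + k * g = f' + k * g' %[mod p] -> f + l * g = f' + l * g' %[mod p] ->
  f = f' /\ g = g'.
Proof.
move=> kp lp kl fp f'p gp g'p /eqP + /eqP.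
rewrite !eqn_mod_Fp !natrD !natrM => /eqP ek /eqP el.
have : (k%:R - l%:R) * (g%:R - g'%:R) == 0 :> 'F_p.
  apply/eqP; rewrite [LHS](_ : _ = (f%:R + k%:R * g%:R) - (f%:R + l%:R * g%:R)
    - (k%:R * g'%:R - l%:R * g'%:R)); last by ring.
  by rewrite ek el; ring.
rewrite mulf_eq0 !subr_eq0 !eq_Fp_small // (negPf kl) /= => /eqP eg.
split=> //; move: ek; rewrite eg => /addIr/eqP.
by rewrite eq_Fp_small // => /eqP.
Qed.

End Progressions.

(** * Candidate sets of hash pairs *)

Section DoubleHashing.
Variables (n d : nat).
Hypothesis n_pr : prime n.+1.
Hypothesis d0 : (0 < d)%N.
Hypothesis dn : (d <= n.+1)%N.
Implicit Types (h : hash_pair n.+1) (s : bin_state n.+1) (r t : 'S_n.+1).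

(** The stride is invertible modulo the prime [n.+1], so the [d <= n.+1] indices give distinct
    terms. *)
Lemma card_candidates h : #|candidates d h| = d.
Proof.
have lt_mod a : (a %% n.+1 < n.+1)%N by rewrite ltn_mod.
have -> : candidates d h
    = [set Ordinal (lt_mod (h.1 + k * h.2.+1)%N) | k : 'I_d].
  apply/setP => z; rewrite inE; apply/existsP/imsetP => [[k /eqP e]|[k _ ->]].
    by exists k => //; apply/val_inj.
  by exists k; rewrite /= eqxx.
rewrite card_imset ?card_ord // => k l /(congr1 val) /= /eqP.
rewrite eqn_modDl eqn_mod_Fp // !natrM => e; apply/val_inj => /=.
have g0 : (h.2.+1%:R != 0 :> 'F_n.+1).
  by rewrite (eq_Fp_small n_pr (b := 0)) // ltnS.
move: e; rewrite -subr_eq0 -mulrBl mulf_eq0 (negPf g0) orbF subr_eq0.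
by rewrite eq_Fp_small ?(leq_trans (ltn_ord _)) // => /eqP.
Qed.

(** Union over the [d ^ 2] pairs of indices at which [x] and [y] may occur: since [x != y] the
    indices differ, and two terms then determine the hash pair. *)
Lemma card_pair_candidates (x y : 'I_n.+1) : x != y ->
  (#|[set h | (x \in candidates d h) && (y \in candidates d h)]| <= d ^ 2)%N.
Proof.
move=> xy.
pose A (q : 'I_d * 'I_d) := [set h : hash_pair n.+1 |
  ((x : nat) == (h.1 + q.1 * h.2.+1) %% n.+1)%N
  && ((y : nat) == (h.1 + q.2 * h.2.+1) %% n.+1)%N].
apply: (@leq_trans (\sum_q #|A q|)).
  under [leqRHS]eq_bigr => q _ do rewrite -sum1_card big_mkcond /=.
  rewrite exchange_big -sum1_card big_mkcond /=; apply: leq_sum => h _.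
  rewrite inE; case: ifP => // /andP[]; rewrite !inE.
  move=> /existsP[k ek] /existsP[l el].
  by rewrite (bigD1 (k, l)) //= inE ek el.
have A1 q : (#|A q| <= 1)%N.
  apply/card_le1_eqP => h h'; rewrite !inE => /andP[/eqP xk /eqP yl].
  move=> /andP[/eqP xk' /eqP yl'].
  have kl : (q.1 : nat) != q.2.
    by apply: contraNneq xy => e; rewrite -val_eqE /= xk yl e.
  have kn (k : 'I_d) : (k < n.+1)%N by apply: leq_trans dn.
  have gn (g : 'I_n) : (g.+1 < n.+1)%N by rewrite ltnS.
  have := two_terms_determine_progression n_pr (kn q.1) (kn q.2) kl
    (ltn_ord h.1) (ltn_ord h'.1) (gn h.2) (gn h'.2).
  move=> [||e1 [e2]]; [by rewrite -xk -xk' | by rewrite -yl -yl' |].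
  case: h h' e1 e2 {xk yl xk' yl'} => f g [f' g'] /= e1 e2.
  by congr pair; apply/val_inj.
apply: (@leq_trans (\sum_(q : 'I_d * 'I_d) 1)); first exact: leq_sum.
by rewrite sum1_card card_prod card_ord mulnn.
Qed.

End DoubleHashing.

(** * Double hashing under a uniformly random ordering *)

Section DoubleHashingTail.
Variables (R : realType) (n d : nat).
Hypothesis n_pr : prime n.+1.
Hypothesis d0 : (0 < d)%N.
Hypothesis dn : (d <= n.+1)%N.
Variables (s : bin_state n.+1) (r : 'S_n.+1) (z : 'I_n.+1).
Implicit Types (h : hash_pair n.+1) (t : 'S_n.+1).

(** By [goes_to_relabel], the number of hash pairs that send the ball to [t z] after relabelling the
    bins by [t]. A random [t] thus randomises the labels and keeps the position of [z]. *)
Definition send_count t : nat :=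
  #|[set h : hash_pair n.+1 | goes_to s r (t @^-1: candidates d h) z]|.

Lemma send_countE t :
  send_count t = (\sum_h goes_to s r (t @^-1: candidates d h) z)%N.
Proof.
by rewrite /send_count -sum1_card big_mkcond; apply: eq_bigr => h _; rewrite inE; case: ifP.
Qed.

(** Every candidate set has [d] elements, and under a random [t] only its size matters, by
    [card_perm_goes_to]. Hence the mean agrees with that of random [d]-subsets. *)
Lemma send_count_sum :
  ('C(n.+1, d) * \sum_t send_count t
    = n.+1 * n * (n.+1`! * 'C((position s r z).-1, d.-1)))%N.
Proof.
under eq_bigr => t _ do rewrite send_countE.
rewrite exchange_big /= big_distrr /=.
have E h : ('C(n.+1, d) * (\sum_(t : 'S_n.+1) goes_to s r (t @^-1: candidates d h) z)
    = n.+1`! * 'C((position s r z).-1, d.-1))%N.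
  have dh := card_candidates n_pr dn h.
  rewrite -[in RHS]dh -card_perm_goes_to dh //; congr (_ * _)%N.
  by rewrite -sum1_card [RHS]big_mkcond; apply: eq_bigr => t _; rewrite inE; case: ifP.
by under eq_bigr => h _ do rewrite E; rewrite sum_nat_const card_prod !card_ord.
Qed.

Definition translation (a : 'I_n.+1) : 'S_n.+1 := perm (@addIr _ a).

Lemma candidates_translation a h :
  translation a @^-1: candidates d (translation a h.1, h.2) = candidates d h.
Proof.
apply/setP => x; rewrite !inE !permE; apply: eq_existsb => k /=.
rewrite modnDml addnAC eqn_modDr.
by rewrite (modn_small (ltn_ord x)).
Qed.

(** A shift of all labels is absorbed by shifting the offset, which permutes the hash pairs. *)
Lemma send_count_translation a t : send_count (t * translation a)%g = send_count t.
Proof.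
rewrite !send_countE.
rewrite (reindex (fun h : hash_pair n.+1 => (translation a h.1, h.2))) /=.
  by apply: eq_bigr => h _; rewrite preimset_permM candidates_translation.
apply: onW_bij; exists (fun h : hash_pair n.+1 => ((translation a)^-1 h.1, h.2)%g).
  by case=> f g; rewrite /= permK.
by case=> f g; rewrite /= permKV.
Qed.

(** With the label [t z] kept fixed, the swap affects only hash pairs whose candidates contain [t z]
    and one of [a], [b]; [card_pair_candidates] allows [d ^ 2] of them for each. *)
Lemma send_count_tperm t a b : t z != a -> t z != b ->
  (send_count (t * tperm a b)%g <= send_count t + 2 * d ^ 2)%N.
Proof.
move=> za zb; pose both y h := (t z \in candidates d h) && (y \in candidates d h).
apply: (@leq_trans (\sum_h (goes_to s r (t @^-1: candidates d h) z
                            + (both a h + both b h)))%N).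
  rewrite send_countE; apply: leq_sum => h _; rewrite /both.
  have [tz|/negPf tz] := boolP (t z \in candidates d h); last first.
    by rewrite {1}/goes_to inE permM tpermD 1?eq_sym // tz.
  case aC: (a \in _); first by apply: leq_trans (leq_b1 _) _; rewrite addnCA.
  case bC: (b \in _); first by apply: leq_trans (leq_b1 _) _; rewrite addnA leq_addl.
  rewrite addn0 preimset_permM; set D := tperm a b @^-1: _.
  suff -> : D = candidates d h by [].
  by apply/setP => x; rewrite inE; case: tpermP => // ->; rewrite aC bC.
rewrite big_split /= -send_countE leq_add2l big_split /= mul2n -addnn.
have bothE y : t z != y -> (\sum_h both y h <= d ^ 2)%N.
  move=> zy; apply: leq_trans (card_pair_candidates n_pr dn zy).
  rewrite -sum1_card [leqRHS]big_mkcond; apply: leq_sum => h _.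
  by rewrite inE /both; case: (_ && _).
by rewrite leq_add ?bothE.
Qed.

Lemma send_count_lipschitz t a b : t z != a -> t z != b ->
  `|(send_count (t * tperm a b)%g)%:R - (send_count t)%:R| <= (2 * d ^ 2)%:R :> R.
Proof.
move=> za zb; have h1 := send_count_tperm za zb.
(* Swapping back gives the reverse inequality. *)
have : (send_count (t * tperm a b * tperm a b)%g
    <= send_count (t * tperm a b)%g + 2 * d ^ 2)%N.
  by apply: send_count_tperm; rewrite permM tpermD // 1?eq_sym.
rewrite -mulgA tperm2 mulg1 => h2.
by rewrite ler_distl lerBlDr -!natrD !ler_nat h1 h2.
Qed.

(** The number of hash pairs times the probability that a random [d]-subset sends the ball to
    [z]. *)
Definition mean_send_count : R :=
  (n.+1 * n)%:R * ('C((position s r z).-1, d.-1)%:R / 'C(n.+1, d)%:R).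

(** Translations make the mean over the [t] with [t z = y] independent of [y], so each conditional
    mean equals the overall mean. *)
Lemma send_count_fiber_sum y :
  \sum_(u : 'S_n) (send_count (lift_perm z y u))%:R = n`!%:R * mean_send_count.
Proof.
have fib y' : \sum_(u : 'S_n) (send_count (lift_perm z y' u))%:R
    = \sum_(u : 'S_n) (send_count (lift_perm z y u))%:R :> R.
  have -> : y' = translation (y' - y) y by rewrite permE addrC subrK.
  rewrite (sum_perm_fiber z y _ (fun t => (send_count t)%:R : R)).
  by apply: eq_bigr => u _; rewrite send_count_translation.
have n0 : (n.+1%:R : R) != 0 by rewrite pnatr_eq0.
have b0 : ('C(n.+1, d)%:R : R) != 0 by rewrite pnatr_eq0 -lt0n bin_gt0.
apply: (mulfI n0); apply: (mulfI b0).
have -> : n.+1%:R * \sum_(u : 'S_n) (send_count (lift_perm z y u))%:R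
    = \sum_t (send_count t)%:R :> R.
  rewrite (sum_lift_perm z); under [RHS]eq_bigr => y' _ do rewrite fib.
  by rewrite sumr_const card_ord mulr_natl.
rewrite -natr_sum -natrM send_count_sum /mean_send_count factS !natrM.
by field.
Qed.

(** The Lipschitz bound covers only transpositions fixing [t z], so concentration is applied within
    each fibre [t z = y], a copy of ['S_n]. *)
Lemma send_count_tail (lam u : R) : 0 <= lam -> lam * (2 * d ^ 2)%:R <= 1 / 2 ->
  #|[set t | mean_send_count + u < (send_count t)%:R]|%:R
    <= n.+1`!%:R * expR (2 * (lam * (2 * d ^ 2)%:R) ^+ 2 * n%:R - lam * u).
Proof.
move=> lam0 lamL.
have cardE (T : finType) (P : pred T) :
    #|[set x | P x]|%:R = \sum_x (P x)%:R :> R.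
  rewrite -sum1_card natr_sum big_mkcond /=.
  by apply: eq_bigr => x _; rewrite inE; case: (P x).
rewrite cardE (sum_lift_perm z) factS natrM -mulrA mulr_natl.
rewrite -[n.+1 in leRHS]card_ord -sumr_const; apply: ler_sum => y _.
apply: le_trans (@perm_concentration R n
  (fun v => (send_count (lift_perm z y v))%:R) _ lam mean_send_count u _ _ lam0 lamL).
- by rewrite cardE.
- move=> v a b; rewrite lift_permMtperm; apply: send_count_lipschitz;
    by rewrite lift_perm_id neq_lift.
- exact: send_count_fiber_sum.
Qed.

End DoubleHashingTail.

(** * One step of the processes *)

Lemma sum_option (R : realType) (I : finType) (F : option I -> R) :
  \sum_o F o = F None + \sum_i F (Some i).
Proof.
rewrite (bigD1 None) //=; congr (_ + _).
rewrite (reindex_omap Some id) /=; last by case.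
by apply: eq_bigl => i; rewrite eqxx.
Qed.

Lemma delta_gt0 (R : realType) n : (0 < n)%N -> 0 < delta R n.
Proof. by move=> n0; rewrite powR_gt0 // ltr0n. Qed.

Lemma powR_natN_le1 (R : realType) n (a : R) :
  (0 < n)%N -> 0 <= a -> n%:R `^ (- a) <= 1 :> R.
Proof.
move=> n0 a0; rewrite -[leRHS](powRr0 n%:R).
by rewrite ler_powR ?ler1n // oppr_le0.
Qed.

Section Kernels.
Variables (R : realType) (d n : nat).
Hypothesis d0 : (0 < d)%N.
Hypothesis dn : (d <= n)%N.
Hypothesis n1 : (1 < n)%N.
Implicit Types (s : bin_state n) (r : 'S_n) (z : 'I_n).

Local Notation p := (next_prob R d n).
Local Notation eta := (eta R d).

Let n0 : (n%:R : R) != 0. Proof. by rewrite pnatr_eq0; lia. Qed.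
Let npair0 : ((n * n.-1)%:R : R) != 0. Proof. by rewrite pnatr_eq0; nia. Qed.
Let nfact0 : (n`!%:R : R) != 0. Proof. by rewrite pnatr_eq0 -lt0n fact_gt0. Qed.

Lemma eta_ge0 s r z : 0 <= eta s r z.
Proof. by rewrite divr_ge0. Qed.

Lemma candidates_neq0 (h : hash_pair n) : candidates d h != set0.
Proof.
apply/set0Pn; exists h.1; rewrite inE; apply/existsP.
by exists (Ordinal d0); rewrite mul0n addn0 modn_small.
Qed.

Lemma eta_total s r : \sum_z eta s r z = 1.
Proof.
rewrite -mulr_suml -natr_sum.
have -> : (\sum_z #|[set h : hash_pair n | goes_to s r (candidates d h) z]|
    = n * n.-1)%N.
  transitivity #|[set: hash_pair n]|; last by rewrite cardsT card_prod !card_ord.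
  rewrite -(card_goes_to_sum s r (C := candidates d)) => [|h _]; last first.
    exact: candidates_neq0.
  apply: eq_bigr => z _; congr #|pred_of_set _|.
  by apply/setP => h; rewrite !inE.
by rewrite divff.
Qed.

(** Rests on [card_goes_to] and the identity [n * 'C(n.-1, d.-1) = d * 'C(n, d)]. *)
Lemma mrh_probE s r z : mrh_prob R d s r z = p (position s r z).
Proof.
rewrite /mrh_prob /next_prob card_goes_to //.
have -> : n%:R `^ (- (14 / 10)) = n%:R `^ (- (4 / 10)) * (1 / n%:R) :> R.
  rewrite mul1r -(powR_inv1 (ler0n R n)) -powRD; last by rewrite n0 implybT.
  by congr powR; field.
rewrite addrC; congr (_ + _); rewrite -!mulrA; congr (_ * _).
have e : n%:R * 'C(n.-1, d.-1)%:R = d%:R * 'C(n, d)%:R :> R.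
  by rewrite -!natrM mul_bin_diag prednK.
have b1 : ('C(n.-1, d.-1)%:R : R) != 0 by rewrite pnatr_eq0 -lt0n bin_gt0; lia.
have b2 : ('C(n, d)%:R : R) != 0 by rewrite pnatr_eq0 -lt0n bin_gt0.
have -> : 'C(n, d)%:R = n%:R * 'C(n.-1, d.-1)%:R / d%:R :> R.
  by rewrite e mulrAC mulfV ?mul1r // pnatr_eq0; lia.
by field; rewrite ?n0 ?b1 // pnatr_eq0; lia.
Qed.

Lemma mrh_prob_ge0 s r z : 0 <= mrh_prob R d s r z.
Proof.
have := @powR_natN_le1 R n (4 / 10) (ltnW n1) ltac:(lra).
have := powR_ge0 n%:R (- (4 / 10) : R) => h1 h2.
by rewrite addr_ge0 // mulr_ge0 ?divr_ge0 ?subr_ge0.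
Qed.

Lemma mrh_total s r : \sum_z mrh_prob R d s r z = 1.
Proof.
rewrite big_split /= sumr_const card_ord -mulr_sumr -mulr_suml -natr_sum.
have -> : (\sum_z #|[set C : {set 'I_n} | (#|C| == d) && goes_to s r C z]|
    = 'C(n, d))%N.
  rewrite -[in RHS](card_ord n) -card_draws.
  rewrite -[RHS](card_goes_to_sum s r (C := id)) => [|C]; last first.
    by rewrite inE -card_gt0 => /eqP ->.
  apply: eq_bigr => z _; congr #|pred_of_set _|.
  by apply/setP => C; rewrite !inE.
rewrite divff ?mulr1; last by rewrite pnatr_eq0 -lt0n bin_gt0.
by rewrite -[_ *+ n]mulr_natr mul1r divfK // addrC subrK.
Qed.

Lemma uniform_ranking_total (F : 'S_n -> R) :
  (forall r, F r = 1) -> \sum_r (n`!%:R)^-1 * F r = 1.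
Proof.
move=> F1; under eq_bigr => r _ do rewrite F1 mulr1.
by rewrite sumr_const card_Sn -[_ *+ _]mulr_natl divff.
Qed.

Lemma dh_kernel_ge0 g o : 0 <= @dh_kernel R d n g o.
Proof. by rewrite mulr_ge0 ?invr_ge0 ?eta_ge0. Qed.

Lemma dh_kernel_total g : \sum_o @dh_kernel R d n g o = 1.
Proof.
rewrite -(pair_bigA _ (fun r z => (n`!%:R)^-1 * eta (final_state g) r z)) /=.
under eq_bigr => r _ do rewrite -mulr_sumr.
by apply: uniform_ranking_total => r; rewrite eta_total.
Qed.

Lemma mrh_kernel_ge0 g o : 0 <= @mrh_kernel R d n g o.
Proof. by rewrite mulr_ge0 ?invr_ge0 ?mrh_prob_ge0. Qed.

Lemma mrh_kernel_total g : \sum_o @mrh_kernel R d n g o = 1.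
Proof.
rewrite -(pair_bigA _ (fun r z => (n`!%:R)^-1 * mrh_prob R d (final_state g) r z)) /=.
under eq_bigr => r _ do rewrite -mulr_sumr.
by apply: uniform_ranking_total => r; rewrite mrh_total.
Qed.

Definition stops (h : seq (cstep n)) r := failed h || failure_test R d (cfinal_state h) r.

(** Past the failure test, [eta] is at most [(1 + delta) * p] at every bin, which is exactly what
    makes the extra-ball weights nonnegative. *)
Lemma coupled_kernel_ge0 h o : 0 <= @coupled_kernel R d n h o.
Proof.
have dl0 := delta_gt0 R (ltnW n1); rewrite /coupled_kernel mulr_ge0 ?invr_ge0 //.
case: o => r [[b z]|] /=; last by case: ifP.
case: ifP => // /norP[_ /existsPn/(_ z)]; rewrite -leNgt => le_p.
case: b; first by rewrite mulr_ge0 ?eta_ge0 // divr_ge0 //; lra.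
by rewrite !mulr_ge0 ?invr_ge0 ?subr_ge0 //; lra.
Qed.

Lemma next_prob_total s r : \sum_z p (position s r z) = 1.
Proof.
by rewrite -[RHS](mrh_total s r); apply: eq_bigr => z _; rewrite mrh_probE.
Qed.

(* Both kinds of balls have total mass one, so that weighting the extra balls
   by [a] only affects the mixture coefficients. *)
Lemma coupled_kernel_weighted (a : R) h :
  \sum_o @coupled_kernel R d n h o
      * (if o.2 is Some (false, _) then a else 1)
    = \sum_r (n`!%:R)^-1
        * (if stops h r then 1 else (1 + a * delta R n) / (1 + delta R n)).
Proof.
have dl0 := delta_gt0 R (ltnW n1).
rewrite -(pair_bigA _ (fun r o => @coupled_kernel R d n h (r, o)
      * (if o is Some (false, _) then a else 1))) /=.
apply: eq_bigr => r _; rewrite sum_option /coupled_kernel -/(stops h r) /= mulr1.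
case: ifP => _; first by rewrite big1 ?addr0 // => -[b z] _; rewrite mulr0 mul0r.
pose G (b : bool) z := n`!%:R^-1 *
    (if b then 1 / (1 + delta R n) * eta (cfinal_state h) r z else
     delta R n / (1 + delta R n) * ((delta R n)^-1 *
     ((1 + delta R n) * p (position (cfinal_state h) r z)
      - eta (cfinal_state h) r z))) * (if b then 1 else a).
rewrite mulr0 add0r (eq_bigr (fun i => G i.1 i.2)); last by case=> [[] z].
rewrite -(pair_bigA _ G) /G /=.
rewrite big_bool /=.
under eq_bigr => z _ do rewrite mulr1 mulrA.
under [X in _ + X]eq_bigr => z _ do rewrite 3!mulrA [_ * a]mulrC mulrA.
rewrite -!mulr_sumr sumrB -mulr_sumr eta_total next_prob_total.
by field; rewrite nfact0 /=; apply/andP; split; lra.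
Qed.

Lemma coupled_kernel_total h : \sum_o @coupled_kernel R d n h o = 1.
Proof.
have dl0 := delta_gt0 R (ltnW n1).
have := coupled_kernel_weighted 1 h; rewrite mul1r divff; last by lra.
have w1 (o : cstep n) : (if o.2 is Some (false, _) then 1 else 1) = 1 :> R.
  by case: o.2 => [[[]]|].
under eq_bigr => o _ do rewrite w1 mulr1.
move=> ->; apply: uniform_ranking_total => r; exact: if_same.
Qed.

End Kernels.

(** * The probability of failure *)

Section NoFailure.
Variables (R : realType) (d n : nat).
Hypothesis d0 : (0 < d)%N.
Hypothesis dn : (d <= n)%N.
Hypothesis n1 : (1 < n)%N.
Implicit Types (s : bin_state n) (r t : 'S_n) (z : 'I_n).

Local Notation mrh := (@mrh_kernel R d n).
Local Notation coupled := (@coupled_kernel R d n).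

Definition relabel_step t (o : step n) : step n := ((t^-1 * o.1)%g, t o.2).

Lemma final_state_relabel t (g : seq (step n)) :
  final_state (map (relabel_step t) g) = relabel t (final_state g).
Proof.
apply/ffunP => z; rewrite !ffunE -!map_comp count_map [RHS]count_map.
by apply: eq_count => o /=; rewrite -(inj_eq (@perm_inj _ t^-1%g)) permK.
Qed.

Lemma mrh_kernel_relabel t g o :
  mrh (map (relabel_step t) g) (relabel_step t o) = mrh g o.
Proof.
rewrite /mrh_kernel final_state_relabel !mrh_probE // /relabel_step /=.
by rewrite position_relabel.
Qed.

(* The law of modified random hashing is invariant under relabelling the bins,
   so at every step the ordering of the bins is a uniformly random one. *)
Lemma mrh_failure_bound (beta : R) (T : nat) :
    (forall s r z,
       #|[set t : 'S_n | (1 + delta R n) * next_prob R d n (position s r z)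
            < eta R d (relabel t s) (t^-1 * r)%g (t z)]|%:R <= n`!%:R * beta) ->
  \sum_(w : T.-tuple (step n) | ~~ never_fails R d w) @mrh_law R d n T w
    <= T%:R * n%:R * beta.
Proof.
move=> tail; pose law (w : T.-tuple (step n)) := law_from mrh [::] w.
pose bad (w : T.-tuple (step n)) := ~~ never_fails R d w.
have law0 w : 0 <= law w by apply: law_from_ge0 => g o; apply: mrh_kernel_ge0.
under eq_bigr => w _ do rewrite /mrh_law trajectory_lawE -/(law w).
change (\sum_(w | bad w) law w <= T%:R * n%:R * beta).
pose act t := map_tuple (relabel_step t) : T.-tuple (step n) -> T.-tuple (step n).
have actE t : \sum_(w | bad w) law w = \sum_(w | bad (act t w)) law w.
  rewrite (reindex (act t)).
    apply: eq_bigr => w _; rewrite /law /=.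
    by rewrite -[LHS]/(law_from mrh (map (relabel_step t) [::]) _)
      (law_from_map (mrh_kernel_relabel t)).
  apply: onW_bij; exists (act t^-1%g) => w; apply: eq_from_tnth => i;
    rewrite !tnth_map /relabel_step /=; case: (tnth w i) => a z /=.
    by rewrite invgK mulKVg permK.
  by rewrite invgK mulKg permKV.
have f0 : 0 < n`!%:R :> R by rewrite ltr0n fact_gt0.
(* Averaging over [t] exchanges the roles: the trajectory [w] is now fixed, and a union bound over
   its steps and bins counts the [t] that make it fail. *)
have avg : n`!%:R * \sum_(w | bad w) law w
    = \sum_(t : 'S_n) \sum_w (bad (act t w))%:R * law w.
  rewrite mulr_natl -card_Sn -sumr_const.
  apply: eq_bigr => t _; rewrite (actE t) big_mkcond; apply: eq_bigr => w _.
  by case: (bad _); rewrite ?mul1r ?mul0r.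
rewrite -(ler_pM2l f0) avg.
rewrite exchange_big /=.
apply: (@le_trans _ _ (\sum_w (n`!%:R * (T%:R * n%:R * beta)) * law w)); last first.
  rewrite -mulr_sumr (law_from_total (K := mrh)) ?mulr1 // => g.
  exact: mrh_kernel_total.
apply: ler_sum => w _; rewrite -mulr_suml ler_wpM2r //.
pose fail (i : 'I_T) (t : 'S_n) z := ((1 + delta R n)
    * next_prob R d n (position (final_state (take i w)) (tnth w i).1 z)
  < eta R d (relabel t (final_state (take i w))) (t^-1 * (tnth w i).1)%g (t z)).
apply: (@le_trans _ _ (\sum_(t : 'S_n) \sum_(i < T) \sum_z (fail i t z)%:R)).
  apply: ler_sum => t _; case: (boolP (bad _)) => [|_]; last first.
    by apply: sumr_ge0 => i _; apply: sumr_ge0.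
  rewrite /bad negb_forall => /existsP[i]; rewrite negbK => /existsP[z].
  rewrite -map_take final_state_relabel tnth_map /=.
  rewrite -(permKV t z) position_relabel => failz.
  rewrite (bigD1 i) //= (bigD1 (t^-1 z)%g) //= -addrA.
  by rewrite /fail failz lerDl addr_ge0 // ?sumr_ge0 // => j _; apply: sumr_ge0.
rewrite exchange_big /=.
apply: (@le_trans _ _ (\sum_(i < T) \sum_(z : 'I_n) n`!%:R * beta)).
  apply: ler_sum => i _; rewrite exchange_big /=; apply: ler_sum => z _.
  apply: le_trans (tail (final_state (take i w)) (tnth w i).1 z).
  rewrite -sum1_card natr_sum [leRHS]big_mkcond /=; apply: ler_sum => t _.
  by rewrite inE -/(fail i t z); case: (fail i t z).
rewrite !sumr_const !card_ord -[_ *+ n]mulr_natl -[_ *+ T]mulr_natl.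
by rewrite le_eqVlt; apply/orP; left; apply/eqP; ring.
Qed.

Lemma cfinal_state_rcons (h : seq (cstep n)) r b z x :
  cfinal_state (rcons h (r, Some (b, z))) x = (cfinal_state h x + (z == x))%N.
Proof.
by rewrite /cfinal_state /placed !ffunE -cats1 pmap_cat count_cat /= addn0.
Qed.

Lemma final_state_rcons (g : seq (step n)) o x :
  final_state (rcons g o) x = (final_state g x + (o.2 == x))%N.
Proof. by rewrite !ffunE map_rcons -cats1 count_cat /= addn0. Qed.

Lemma failed_rcons (h : seq (cstep n)) o :
  failed (rcons h o) = failed h || (o.2 == None).
Proof. by rewrite /failed -cats1 has_cat /= orbF. Qed.

(** Given [w], only the kinds of the balls remain free. Summing over the two kinds cancels [eta] and
    leaves the probability [p] of modified random hashing. *)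
Lemma places_as_law T (h : seq (cstep n)) (g w : seq (step n)) :
    size w = T -> ~~ failed h -> cfinal_state h = final_state g ->
    (forall (i : nat) o, (i < T)%N ->
       ~~ failure_test R d (final_state (g ++ take i w)) (nth o w i).1) ->
  \sum_(u : T.-tuple (cstep n) | places_as w u) law_from coupled h u
    = law_from mrh g w.
Proof.
elim: T h g w => [|T IH] h g [|o w] //= => [_|[szw]] nf hg nt.
  by rewrite (sum_tuple0 (places_as [::])).
rewrite (sum_tupleS T (places_as (o :: w))).
pose b_step b : cstep n := (o.1, Some (b, o.2)).
rewrite (bigID (fun a : cstep n => (a.1, omap snd a.2) == (o.1, Some o.2))) /=.
rewrite [X in _ + X]big1 ?addr0; last first.
  move=> a /negPf na; rewrite big_pred0 // => u.
  by rewrite /places_as /= eqseq_cons na.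
rewrite (reindex_omap b_step (fun a => omap fst a.2)) /=; last first.
  by move=> [r [[b z]|]] /= /eqP[] // -> ->.
under eq_bigl => b do rewrite !eqxx /=.
have ntest : ~~ failure_test R d (cfinal_state h) o.1.
  by have := nt 0 o isT; rewrite hg /= cats0.
transitivity (\sum_b coupled h (b_step b) * law_from mrh (rcons g o) w).
  apply: eq_bigr => b _; rewrite -mulr_sumr; congr (_ * _).
  rewrite -(IH (rcons h (b_step b))) //.
  - by apply: eq_bigl => u; rewrite /places_as /= eqseq_cons eqxx.
  - by rewrite failed_rcons negb_or nf.
  - by apply/ffunP => x; rewrite cfinal_state_rcons final_state_rcons hg.
  - by move=> i o' iT; have := nt i.+1 o' iT; rewrite /= cat_rcons.
rewrite -mulr_suml; congr (_ * _); rewrite big_bool /coupled_kernel /=.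
rewrite (negPf nf) (negPf ntest) /= /mrh_kernel -hg mrh_probE //.
have dl0 := delta_gt0 R (ltnW n1).
by field; rewrite pnatr_eq0 -lt0n fact_gt0 !gt_eqF ?addr_gt0.
Qed.

Lemma coupled_places_as T (w : T.-tuple (step n)) : never_fails R d w ->
  Pr (@coupled_law R d n T) (fun u => places_as w u) = @mrh_law R d n T w.
Proof.
move=> /forallP nf; rewrite /mrh_law trajectory_lawE.
rewrite -(places_as_law (T := T) (h := [::]) (g := [::])) ?size_tuple //.
- by apply: eq_bigr => u _; rewrite /coupled_law trajectory_lawE.
- by move=> i o iT; have := nf (Ordinal iT); rewrite (tnth_nth o).
Qed.

(** The events [places_as w], for [w] passing every failure test, are disjoint and free of failure.
    Their total mass is the probability of [never_fails] under modified random hashing, which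
    [mrh_failure_bound] controls. *)
Lemma coupled_not_failed (beta : R) (T : nat) :
    (forall s r z,
       #|[set t : 'S_n | (1 + delta R n) * next_prob R d n (position s r z)
            < eta R d (relabel t s) (t^-1 * r)%g (t z)]|%:R <= n`!%:R * beta) ->
  1 - T%:R * n%:R * beta <= Pr (@coupled_law R d n T) (fun u => ~~ failed u).
Proof.
move=> /(mrh_failure_bound T) bad.
have tot : \sum_w @mrh_law R d n T w = 1.
  under eq_bigr => w _ do rewrite /mrh_law trajectory_lawE.
  by rewrite (law_from_total (K := mrh)) // => g; apply: mrh_kernel_total.
have := tot; rewrite (bigID (never_fails R d (T := T))) /= => tot2.
apply: (@le_trans _ _ (\sum_(w : T.-tuple (step n) | never_fails R d w) @mrh_law R d n T w)).
  by rewrite lerBlDr -[leLHS]tot2 lerD2l; exact: bad.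
under eq_bigr => w nf do rewrite -coupled_places_as // /Pr big_mkcond /=.
rewrite exchange_big /= [leRHS]big_mkcond /=; apply: ler_sum => u _.
have law0 : 0 <= @coupled_law R d n T u.
  rewrite /coupled_law trajectory_lawE law_from_ge0 // => h o.
  exact: coupled_kernel_ge0.
pose P := [pred w : T.-tuple (step n) | never_fails R d w && places_as w u].
rewrite -big_mkcondr /=; case: (pickP P) => [w0 /andP[_ pw0]|noP]; last first.
  by rewrite big_pred0 //; case: ifP.
have uniqw (w : T.-tuple (step n)) : places_as w u -> w = w0.
  move: pw0; rewrite /places_as => /eqP -> /eqP e; apply/val_inj.
  apply: (@inj_map _ _ (fun o : step n => (o.1, Some o.2))); last exact: esym e.
  by move=> [a b] [a' b'] /= [-> ->].
have nfu : ~~ failed u.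
  rewrite /failed -all_predC; apply/allP => o ou /=.
  have : (o.1, omap snd o.2) \in [seq (o.1, Some o.2) | o <- w0].
    by rewrite -(eqP pw0); apply: (map_f (fun o : cstep n => (o.1, omap snd o.2))).
  by case/mapP => o' _ [_]; case: o.2.
rewrite nfu (bigID (pred1 w0)) /= [X in _ + X]big1 ?addr0; last first.
  by move=> w /andP[/andP[_ /uniqw ->]]; rewrite eqxx.
rewrite big_mkcond (bigD1 w0) //= big1 ?addr0 => [|w /negPf nw]; last first.
  by rewrite nw andbF.
by case: ifP.
Qed.

End NoFailure.

(** * The dominating coupling *)

(* Two tables that are given the same candidates and the same ranking keep
   their domination relation; sharing the ranking matters when loads tie. *)
Lemma goes_to_dominates n (s s' : bin_state n) (r : 'S_n) C z z' :
    dominates s s' -> goes_to s r C z -> goes_to s' r C z' ->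
  forall x, (s' x + (z' == x) <= s x + (z == x))%N.
Proof.
move=> /forallP dom /andP[zC /forall_inP zb] /andP[z'C /forall_inP zb'] x.
have le x' := dom x'.
case: eqP => [<-{x}|_]; last by rewrite addn0 (leq_trans (le x)) ?leq_addr.
case: eqP => [_|/eqP zz']; first by rewrite leq_add2r.
have := zb _ z'C; have := zb' _ zC; rewrite (negPf zz') [z' == z]eq_sym (negPf zz') /= /before.
have := le z; have := le z'; move: (r z : nat) (r z' : nat) => a b.
by move=> h1 h2 /orP h3 /orP h4; case: h3 => [h3|/andP[/eqP h3 h3']];
  case: h4 => [h4|/andP[/eqP h4 h4']]; lia.
Qed.

Section Coupling.
Variables (R : realType) (d n : nat).
Hypothesis d0 : (0 < d)%N.
Hypothesis dn : (d <= n)%N.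
Hypothesis n1 : (1 < n)%N.
Implicit Types (s : bin_state n) (r : 'S_n) (z : 'I_n).
Implicit Types (h u : seq (cstep n)) (g v : seq (step n)).

Local Notation dh := (@dh_kernel R d n).
Local Notation coupled := (@coupled_kernel R d n).
Local Notation dlt := (delta R n).

(** Joint law of the destinations in two tables that share the ranking and the hash pair. *)
Definition joint_eta s s' r z z' : R :=
  #|[set a : hash_pair n | goes_to s r (candidates d a) z
                           && goes_to s' r (candidates d a) z']|%:R
    / (n * n.-1)%:R.

Lemma joint_eta_suml s s' r z' : \sum_z joint_eta s s' r z z' = eta R d s' r z'.
Proof.
rewrite -mulr_suml -natr_sum /eta -(card_goes_to_sum s r
  (fun a _ => candidates_neq0 d0 a)).
congr (_%:R / _); apply: eq_bigr => z _; congr #|pred_of_set _|.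
by apply/setP => a; rewrite !inE andbC.
Qed.

Lemma joint_eta_sumr s s' r z : \sum_z' joint_eta s s' r z z' = eta R d s r z.
Proof.
rewrite -mulr_suml -natr_sum /eta -(card_goes_to_sum s' r
  (fun a _ => candidates_neq0 d0 a)).
congr (_%:R / _); apply: eq_bigr => z' _; congr #|pred_of_set _|.
by apply/setP => a; rewrite !inE.
Qed.

(* Law of the future [p :: v] of the double hashing table when the coupled
   algorithm stops at a step with ranking [r]: it still makes a step, with
   ranking [r], with probability [1 / (1 + delta)]. *)
Definition stopped_law g r (p : step n) v : R :=
  1 / (1 + dlt) * (p.1 == r)%:R * eta R d (final_state g) p.1 p.2
    * law_from dh (rcons g p) v
  + dlt / (1 + dlt) * law_from dh g (p :: v).

(* Joint law of the futures of the coupled algorithm, with past [h], and of the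
   double hashing process, with past [g]: double hashing balls use the same
   ranking and the same hash pair in both, extra balls make the second wait. *)
Fixpoint joint_law h g u v : R :=
  match u, v with
  | [::], _ => law_from dh g v
  | _, [::] => law_from coupled h u
  | o :: u', p :: v' =>
    match o.2 with
    | None => coupled h o * law_from coupled (rcons h o) u' * stopped_law g o.1 p v'
    | Some (false, _) => coupled h o * joint_law (rcons h o) g u' v
    | Some (true, z) =>
      if stops R d h o.1 then 0
      else (n`!%:R)^-1 * (1 / (1 + dlt)) * (p.1 == o.1)%:R
           * joint_eta (cfinal_state h) (final_state g) o.1 z p.2
           * joint_law (rcons h o) (rcons g p) u' v'
    end
  end.

Let dlt0 : 0 < dlt. Proof. exact: delta_gt0 (ltnW n1). Qed.
Let dlt1 : 1 + dlt != 0. Proof. by rewrite gt_eqF ?addr_gt0. Qed.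

Lemma stopped_law_ge0 g r p v : 0 <= stopped_law g r p v.
Proof.
have lawd := @law_from_ge0 _ _ dh _ _ (@dh_kernel_ge0 R d n).
have e := @eta_ge0 R d n.
by rewrite addr_ge0 // !mulr_ge0 ?invr_ge0 // ?addr_ge0 // ltW.
Qed.

Lemma joint_law_ge0 h g u v : 0 <= joint_law h g u v.
Proof.
have lawd g' v' : 0 <= law_from dh g' v'.
  by apply: law_from_ge0 => *; apply: dh_kernel_ge0.
have lawc h' u' : 0 <= law_from coupled h' u'.
  by apply: law_from_ge0 => *; apply: coupled_kernel_ge0.
elim: u h g v => [|o u IH] h g v; first exact: lawd.
case: v => [|p v] /=; first by rewrite mulr_ge0 ?coupled_kernel_ge0.
case: o.2 => [[[] z]|].
- by case: ifP => // _; rewrite !mulr_ge0 ?invr_ge0 ?addr_ge0 ?(ltW dlt0).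
- by rewrite mulr_ge0 ?coupled_kernel_ge0.
- apply: mulr_ge0 (stopped_law_ge0 _ _ _ _); apply: mulr_ge0 => //.
  exact: coupled_kernel_ge0.
Qed.

Lemma sum_ranking_indicator r (F : step n -> R) :
  \sum_p (p.1 == r)%:R * F p = \sum_z F (r, z).
Proof.
rewrite (eq_bigr (fun p => (p.1 == r)%:R * F (p.1, p.2))); last by case.
rewrite -(pair_bigA _ (fun r' z => (r' == r)%:R * F (r', z))) /=.
rewrite (bigD1 r) //= [X in _ + X]big1 ?addr0 => [|r' /negPf rr'].
  by apply: eq_bigr => z _; rewrite eqxx mul1r.
by rewrite big1 // => z _; rewrite rr' mul0r.
Qed.

Lemma stopped_law_total g r m :
  \sum_p \sum_(v : m.-tuple (step n)) stopped_law g r p v = 1.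
Proof.
have dtot g' k : \sum_(v : k.-tuple (step n)) law_from dh g' v = 1.
  by apply: law_from_total => *; apply: dh_kernel_total.
under eq_bigr => p _ do rewrite big_split /= -mulr_sumr dtot mulr1 -mulr_sumr.
rewrite big_split /= -[X in _ + X]mulr_sumr.
rewrite -(sum_tupleS m predT (law_from dh g)) dtot mulr1.
under eq_bigr => p _ do rewrite -mulrA.
rewrite -mulr_sumr sum_ranking_indicator /= (eta_total R d0 dn n1) mulr1.
by rewrite -mulrDl divff.
Qed.

(** By induction on [u]: a shared step is summed out by [joint_eta_sumr], an extra ball leaves [v]
    whole, and a stop is handled by [stopped_law_total]. *)
Lemma joint_law_marginl m h g u :
  \sum_(v : m.-tuple (step n)) joint_law h g u v = law_from coupled h u.
Proof.
have dtot g' k : \sum_(v : k.-tuple (step n)) law_from dh g' v = 1.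
  by apply: law_from_total => *; apply: dh_kernel_total.
elim: u m h g => [|o u IH] m h g; first exact: dtot.
case: m => [|m]; first by rewrite (sum_tuple0 predT (joint_law h g (o :: u))).
rewrite (sum_tupleS m predT (joint_law h g (o :: u))) /=.
case E: o.2 => [[[] z]|].
- case: o E => r o /= ->; rewrite [X in _ = X * _]/coupled_kernel -/(stops R d h r) /=.
  case: ifP => _; first by rewrite mulr0 mul0r big1 // => p _; rewrite big1.
  rewrite (eq_bigr (fun p : step n => (p.1 == r)%:R
      * (n`!%:R^-1 * (1 / (1 + dlt)) * law_from coupled (rcons h (r, Some (true, z))) u
         * joint_eta (cfinal_state h) (final_state g) r z p.2))); last first.
    by move=> p _; rewrite -mulr_sumr IH; ring.
  rewrite sum_ranking_indicator /= -mulr_sumr joint_eta_sumr.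
  by ring.
- rewrite -(IH m.+1 (rcons h o) g) mulr_sumr.
  by rewrite (sum_tupleS m predT (fun v => _ * joint_law _ _ _ v)).
- under eq_bigr => p _ do rewrite -mulr_sumr.
  by rewrite -mulr_sumr stopped_law_total mulr1.
Qed.

Lemma joint_law_marginr T h g v :
  \sum_(u : T.-tuple (cstep n)) joint_law h g u v = law_from dh g v.
Proof.
have ctot h' k : \sum_(u : k.-tuple (cstep n)) law_from coupled h' u = 1.
  by apply: law_from_total => *; apply: coupled_kernel_total.
elim: T h g v => [|T IH] h g v.
  by rewrite (sum_tuple0 predT (joint_law h g ^~ v)).
case: v => [|p v].
  have -> : law_from dh g [::] = \sum_(u : T.+1.-tuple (cstep n)) law_from coupled h u.
    by rewrite ctot.
  by apply: eq_bigr => u _; case: u => -[].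
rewrite (sum_tupleS T predT (joint_law h g ^~ (p :: v))) /=.
(* For each ranking [r], whether or not the algorithm stops, the step contributes
   [stopped_law g r p v]. Averaging over [r] turns the indicator into the kernel [dh], and the two
   mixture weights add to one. *)
transitivity (\sum_r (n`!%:R)^-1 * stopped_law g r p v); last first.
  rewrite -mulr_sumr /stopped_law big_split /= sumr_const card_Sn.
  rewrite (bigD1 p.1) //= eqxx [X in _ + X + _]big1 => [|r /negPf rp]; last first.
    by rewrite eq_sym rp mulr0 !mul0r.
  rewrite (_ : true%:R = 1 :> R) // addr0 -[X in _ + X]mulr_natl.
  have -> : dh g p = n`!%:R^-1 * eta R d (final_state g) p.1 p.2 by [].
  by field; rewrite dlt1 pnatr_eq0 -lt0n fact_gt0.
pose Q r o := \sum_(u : T.-tuple (cstep n)) joint_law h g ((r, o) :: u) (p :: v).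
rewrite (eq_bigr (fun a => Q a.1 a.2)); last by case.
rewrite -(pair_bigA _ Q) /Q /=.
apply: eq_bigr => r _; rewrite sum_option /=.
rewrite -mulr_suml -mulr_sumr ctot mulr1.
pose G (b : bool) z : R :=
  \sum_(u : T.-tuple (cstep n)) joint_law h g ((r, Some (b, z)) :: u) (p :: v).
rewrite (eq_bigr (fun i => G i.1 i.2)); last by case=> [b z].
rewrite -(pair_bigA _ G) big_bool /G /=.
under [X in _ + (_ + X)]eq_bigr => z _ do rewrite -mulr_sumr IH.
rewrite -mulr_suml /coupled_kernel /= -/(stops R d h r).
case: (stops R d h r).
  rewrite mulr1 [X in _ + (X + _)]big1 => [|z _]; last by rewrite big1.
  by rewrite big1 ?mul0r ?addr0 // => z _; rewrite mulr0.
under eq_bigr => z _ do rewrite -mulr_sumr IH mulrAC.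
rewrite -mulr_sumr joint_eta_suml mulr0 mul0r add0r -mulr_sumr -mulr_sumr -mulr_sumr.
rewrite sumrB -mulr_sumr (eta_total R d0 dn n1) (next_prob_total R d0 dn n1) /stopped_law.
rewrite -[law_from dh g (p :: v)]/(dh g p * law_from dh (rcons g p) v).
have f0 : (n`!%:R : R) != 0 by rewrite pnatr_eq0 -lt0n fact_gt0.
by case: eqP => [->|_]; rewrite [nat_of_bool _]/= ?mulr0n ?mulr1n; field;
  rewrite f0 dlt1 gt_eqF.
Qed.

Lemma cfinal_state_cat_ge h u x : (cfinal_state h x <= cfinal_state (h ++ u) x)%N.
Proof. by rewrite !ffunE /placed pmap_cat count_cat leq_addr. Qed.

(** Nonzero joint mass yields a common hash pair at each shared step, so [goes_to_dominates]
    applies; extra balls only raise the first table. The bound on [size v] ensures that every ball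
    of [v] is matched. *)
Lemma joint_law_dominates h g u v :
    joint_law h g u v != 0 -> dominates (cfinal_state h) (final_state g) ->
    ~~ failed (h ++ u) -> (size v <= dh_balls u)%N ->
  dominates (cfinal_state (h ++ u)) (final_state (g ++ v)).
Proof.
elim: u h g v => [|o u IH] h g [|p v]; rewrite ?cats0 //= => J0 dom.
  move=> _ _; apply/forallP => x.
  exact: leq_trans (forallP dom x) (cfinal_state_cat_ge _ _ _).
rewrite -cat_rcons => nf; move: J0; case: o nf => r [[b z]|] /= nf; last first.
  by move: nf; rewrite /failed has_cat has_rcons eqxx.
case: b nf => nf J0 szv; last first.
  apply: IH => //; first by apply: contraNneq J0 => ->; rewrite mulr0.
  apply/forallP => x; rewrite cfinal_state_rcons.
  by rewrite (leq_trans (forallP dom x)) ?leq_addr.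
rewrite -cat_rcons; move: J0; case: ifP => [_|_]; first by rewrite eqxx.
rewrite mulf_eq0 negb_or => /andP[+ J0].
rewrite !mulf_eq0 !negb_or => /andP[/andP[_ +] /andP[+ _]].
rewrite !pnatr_eq0 eqb0 negbK -lt0n card_gt0 => /eqP pr /set0Pn[a].
rewrite inE => /andP[az ap].
apply: IH => //; apply/forallP => x; rewrite cfinal_state_rcons final_state_rcons.
exact: (goes_to_dominates dom az ap).
Qed.

Lemma coupled_dominates T m (e : R) :
    1 - e <= Pr (@coupled_law R d n T)
      (fun u : T.-tuple (cstep n) => ~~ failed u && (m <= dh_balls u)%N) ->
  exists J : T.-tuple (cstep n) * m.-tuple (step n) -> R,
    is_coupling (@coupled_law R d n T) (@dh_law R d n m) J /\
    1 - e <= Pr J (fun x => dominates (cfinal_state x.1) (final_state x.2)).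
Proof.
move=> likely; exists (fun x : _ * _ => joint_law [::] [::] (tval x.1) (tval x.2)); split.
  split=> [x|u|v]; first exact: joint_law_ge0.
    by rewrite joint_law_marginl /coupled_law trajectory_lawE.
  by rewrite joint_law_marginr /dh_law trajectory_lawE.
apply: le_trans likely _; rewrite /Pr.
pose good (u : T.-tuple (cstep n)) := ~~ failed u && (m <= dh_balls u)%N.
pose F (u : T.-tuple (cstep n)) (v : m.-tuple (step n)) :=
  if good u then joint_law [::] [::] u v else 0.
have -> : \sum_(u | good u) coupled_law R d u = \sum_x F x.1 x.2.
  rewrite big_mkcond -(pair_bigA _ F); apply: eq_bigr => u _ /=.
  rewrite /F; case: (good u); last by rewrite big1.
  by rewrite joint_law_marginl /coupled_law trajectory_lawE.
rewrite [leRHS]big_mkcond; apply: ler_sum => -[u v] _; rewrite /F /=.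
have J0 := joint_law_ge0 [::] [::] u v.
case: ifP => [/andP[nf mb]|_]; last by case: ifP.
case: (eqVneq (joint_law [::] [::] u v) 0) => [->|Jn0]; first by rewrite if_same.
rewrite (joint_law_dominates (h := [::]) (g := [::]) Jn0) ?size_tuple //.
by apply/forallP => x; rewrite !ffunE.
Qed.

End Coupling.

(** * Quantitative bounds *)

Section ExtraBalls.
Variables (R : realType) (d n : nat).
Hypothesis d0 : (0 < d)%N.
Hypothesis dn : (d <= n)%N.
Hypothesis n1 : (1 < n)%N.

Local Notation coupled := (@coupled_kernel R d n).
Local Notation dlt := (delta R n).

(** The value [3 / 2] is the inverse of [1 - 1 / 3], hence at least [expR (1 / 3)]. *)
Let weight (o : cstep n) : R := if o.2 is Some (false, _) then 3 / 2 else 1.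

Let weight_ge1 o : 1 <= weight o.
Proof. by rewrite /weight; case: o.2 => [[[]]|] *; lra. Qed.

Lemma extra_balls_weight (u : seq (cstep n)) : ~~ failed u ->
  expR ((size u)%:R / 3 - (dh_balls u)%:R / 3) <= \prod_(o <- u) weight o.
Proof.
elim: u => [|o u IH] /=; first by rewrite big_nil mul0r subr0 expR0.
rewrite /failed /= negb_or => /andP[oN /IH {}IH].
rewrite big_cons; case: o oN => r [[b z]|] //= _.
have step x y : expR (x - y) <= \prod_(o <- u) weight o ->
    expR (1 / 3 + x - y) <= 3 / 2 * \prod_(o <- u) weight o.
  move=> h; rewrite -addrA expRD ler_pM ?expR_ge0 //.
  have := expRxMexpNx_1 (1 / 3 : R); have := expR_ge1Dx (- (1 / 3) : R).
  have := expR_gt0 (1 / 3 : R); move: (expR _) (expR _) => a b'; nra.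
case: b; rewrite /weight /= ?mul1r ?add1n ?add0n.
  by apply: le_trans IH; rewrite ler_expR -!natr1; lra.
by rewrite -natr1 mulrDl [_ / 3 + 1 / 3]addrC; apply: step.
Qed.

(** Fewer than [m] double hashing balls force at least [2 * delta * m] extra balls, about twice the
    expected number; Markov's inequality is applied to the product of the weights. *)
Lemma extra_balls_tail (T m : nat) :
    dlt <= 1 / 6 ->
    (1 + 2 * dlt) * m%:R - 1 <= T%:R <= (1 + 2 * dlt) * m%:R + 1 ->
  Pr (@coupled_law R d n T) (fun u => ~~ failed u && (dh_balls u < m)%N)
    <= expR (1 - dlt * m%:R / 12).
Proof.
move=> dlt6 /andP[T1 T2]; have dlt0 := delta_gt0 R (ltnW n1).
have m0 : 0 <= m%:R :> R by [].
pose B := 1 + dlt / (2 * (1 + dlt)).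
have step h : \sum_o coupled h o * weight o <= B.
  rewrite (coupled_kernel_weighted d0 dn n1).
  have -> : (1 + 3 / 2 * dlt) / (1 + dlt) = B by rewrite /B; field; lra.
  have B1 : 1 <= B by rewrite lerDl divr_ge0 //; lra.
  apply: (@le_trans _ _ (\sum_(r : 'S_n) n`!%:R^-1 * B)).
    by apply: ler_sum => r _; rewrite ler_wpM2l ?invr_ge0 //; case: ifP.
  rewrite sumr_const card_Sn -[_ *+ n`!]mulr_natl mulrA divff ?mul1r //.
  by rewrite pnatr_eq0 -lt0n fact_gt0.
have w0 o : 0 <= weight o by apply: le_trans (weight_ge1 o).
have := law_from_product_bound T [::] (@coupled_kernel_ge0 R d n n1) step w0.
move=> bound.
have E1 : B ^+ T <= expR (dlt / (2 * (1 + dlt)) * T%:R).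
  rewrite expRM_natr lerXn2r ?nnegrE ?expR_ge0 ?expR_ge1Dx //.
  by rewrite addr_ge0 ?divr_ge0 //; lra.
suff E2 : Pr (@coupled_law R d n T) (fun u => ~~ failed u && (dh_balls u < m)%N)
    * expR (2 * dlt * m%:R / 3) <= expR (dlt / (2 * (1 + dlt)) * T%:R).
  rewrite -ler_pdivlMr ?expR_gt0 // -expRN -expRD in E2.
  apply: le_trans E2 _; rewrite ler_expR.
  (* As [delta <= 1 / 6], the ratio [(1 + 2 * delta) / (2 * (1 + delta))] is at most
     [4 / 7 < 7 / 12]; the rate is then [2 / 3 - 7 / 12 = 1 / 12]. *)
  have : dlt / (2 * (1 + dlt)) * T%:R <= dlt * m%:R * (7 / 12) + 1.
    rewrite mulrAC ler_pdivrMr; last by lra.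
    have : dlt * T%:R <= dlt * ((1 + 2 * dlt) * m%:R + 1) by rewrite ler_pM2l.
    have : 0 <= dlt * m%:R by rewrite mulr_ge0 // ltW.
    move: (m%:R : R) (T%:R : R) m0 => a b; nra.
  by lra.
apply: le_trans E1; apply: le_trans bound.
rewrite mulr_suml big_mkcond; apply: ler_sum => u _ /=.
rewrite /coupled_law trajectory_lawE.
have law0 : 0 <= law_from coupled [::] u.
  by apply: law_from_ge0 => *; apply: coupled_kernel_ge0.
case: ifP => [/andP[nf lt_m]|_]; last first.
  by rewrite mulr_ge0 // prodr_ge0.
rewrite ler_wpM2l //; apply: le_trans (extra_balls_weight nf).
rewrite ler_expR size_tuple.
(* The strict inequality yields the unit that compensates for the rounding of [T]. *)
have : (dh_balls u)%:R + 1 <= m%:R :> R by rewrite natr1 ler_nat.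
by move: T1; move: (dh_balls u)%:R => k; lra.
Qed.

End ExtraBalls.

Section FailureTail.
Variables (R : realType) (d n : nat).
Hypothesis d0 : (0 < d)%N.
Hypothesis dn : (d <= n)%N.
Hypothesis n_pr : prime n.

(** The uniform share of modified random hashing adds at least [n.-1 * nu] hash pairs to the
    threshold, with [nu] equal to [n] to the power [-0.4]; this is the allowed deviation. The
    hypothesis lets [1 + delta] make up for the weight [1 - nu] of the main term. *)
Lemma failure_tail (s : bin_state n) r z :
    1 <= (1 + delta R n) * (1 - n%:R `^ (- (4 / 10))) ->
  #|[set t : 'S_n | (1 + delta R n) * next_prob R d n (position s r z)
       < eta R d (relabel t s) (t^-1 * r)%g (t z)]|%:R
  <= n`!%:R * expR (- ((n%:R `^ (- (4 / 10))) ^+ 2 * n.-1%:R / (32 * d%:R ^+ 4))) :> R.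
Proof.
case: n n_pr dn s r z => [|n'] // pr dn' s r z slack.
have n1 := prime_gt1 pr.
set nu : R := _ `^ _ in slack *.
have nu0 : 0 < nu by rewrite powR_gt0 ?ltr0n.
have nu1 : nu <= 1 by apply: powR_natN_le1 => //; lra.
have dR : 1 <= d%:R :> R by rewrite ler1n.
pose L : R := (2 * d ^ 2)%:R.
have LE : L = 2 * d%:R ^+ 2 by rewrite /L natrM natrX.
have L1 : 1 <= L by rewrite LE; nra.
(* This minimises [2 * (lam * L) ^+ 2 * n' - lam * (n' * nu)]; the minimum is
   [- n' * nu ^+ 2 / (8 * L ^+ 2)], where [8 * L ^+ 2 = 32 * d ^ 4]. *)
pose lam := nu / (4 * L ^+ 2).
have lam0 : 0 <= lam by rewrite divr_ge0 ?(ltW nu0) // mulr_ge0 ?sqr_ge0.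
have lamL : lam * L <= 1 / 2.
  rewrite /lam mulrAC ler_pdivrMr; last by rewrite mulr_gt0 // exprn_gt0 //; lra.
  by nra.
apply: le_trans (_ : _ <= (n'.+1)`!%:R
    * expR (2 * (lam * L) ^+ 2 * n'%:R - lam * (n'%:R * nu))) _.
  apply: le_trans (send_count_tail pr d0 dn' s r z (n'%:R * nu) lam0 lamL).
  rewrite ler_nat; apply/subset_leq_card/subsetP => t; rewrite !inE.
  have -> : eta R d (relabel t s) (t^-1 * r)%g (t z)
      = (send_count d s r z t)%:R / (n'.+1 * n')%:R.
    congr (_%:R / _); congr #|pred_of_set _|; apply/setP => h.
    by rewrite !inE goes_to_relabel.
  rewrite -(mrh_probE R d0 dn' n1) /mrh_prob card_goes_to // /mean_send_count.
  have nn0 : 0 < (n'.+1 * n')%:R :> R by rewrite ltr0n; lia.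
  rewrite ltr_pdivlMr //; apply: le_lt_trans.
  set Q := _ / 'C(_, _)%:R.
  have Q0 : 0 <= Q by rewrite divr_ge0.
  have n0 : 0 < n'.+1%:R :> R by rewrite ltr0n.
  have n'0 : 0 <= n'%:R :> R by [].
  have -> : (1 + delta R n'.+1) * (nu * (1 / n'.+1%:R) + (1 - nu) * Q) * (n'.+1 * n')%:R
      = (1 + delta R n'.+1) * (n'%:R * nu)
        + (1 + delta R n'.+1) * (1 - nu) * ((n'.+1 * n')%:R * Q).
    by rewrite natrM; field; rewrite addrC natr1 gt_eqF.
  rewrite [leLHS]addrC; apply: lerD; rewrite -[leLHS]mul1r ler_wpM2r //.
  - by rewrite mulr_ge0 // ltW.
  - by rewrite lerDl ltW // delta_gt0.
  - by rewrite mulr_ge0.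
rewrite ler_wpM2l // ler_expR le_eqVlt; apply/orP; left; apply/eqP.
by rewrite /lam LE /=; field; rewrite gt_eqF //; lra.
Qed.

End FailureTail.

(** * Asymptotics *)

Section Asymptotics.
Variable R : realType.

Lemma rounds_to_bounds (x : R) k : rounds_to x k -> x - 1 <= k%:R <= x + 1.
Proof.
move=> /andP[fk kc]; apply/andP; split.
  rewrite lerBlDr; apply: le_trans (ltW (floorD1_gt x)) _.
  by rewrite intrD lerD2r -[k%:R]/(k%:Z%:~R) ler_int.
have := ceilB1_lt x; rewrite intrB ltrBlDr => /ltW; apply: le_trans.
by rewrite -[k%:R]/(k%:Z%:~R) ler_int.
Qed.

(** A single term of the exponential series bounds [expR y] from below. *)
Lemma expRN_le_pow k (y : R) : 0 < y -> expR (- y) <= k.+1`!%:R / y ^+ k.+1.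
Proof.
move=> y0; rewrite expRN -[leRHS]invrK invfM invrK.
have p0 : 0 < k.+1`!%:R^-1 * y ^+ k.+1.
  by rewrite mulr_gt0 ?exprn_gt0 // invr_gt0 ltr0n fact_gt0.
rewrite lef_pV2 ?posrE ?expR_gt0 //.
by apply: le_trans (expR_ge1Dxn k (ltW y0)); rewrite mulrC lerDr.
Qed.

Lemma powR_nat_eventually (M a : R) : 0 <= M -> 0 < a ->
  exists N : nat, forall n, (N <= n)%N -> M <= n%:R `^ a.
Proof.
move=> M0 a0; exists (Num.bound (M `^ a^-1)) => n Nn.
have le_n : M `^ a^-1 <= n%:R.
  apply: le_trans (ltW (archi_boundP (powR_ge0 _ _))) _.
  by rewrite ler_nat.
have -> : M = (M `^ a^-1) `^ a by rewrite -powRrM mulVf ?powRr1 ?lt0r_neq0.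
by apply: ge0_ler_powR le_n; rewrite ?nnegrE ?powR_ge0 ?(ltW a0).
Qed.

(** The series term of degree [k.+1] leaves one spare power of [x]. *)
Lemma poly_expRN_bound k (C D : R) : 0 < C -> 0 < D ->
  exists K : R, 0 < K /\
    forall x, 0 < x -> C * x ^+ k * expR (- (x / D)) <= K / x.
Proof.
move=> C0 D0; exists (C * k.+1`!%:R * D ^+ k.+1); split=> [|x x0].
  by rewrite !mulr_gt0 ?exprn_gt0 // ltr0n fact_gt0.
have h := expRN_le_pow k (divr_gt0 x0 D0).
apply: le_trans (ler_wpM2l _ h) _; first by rewrite mulr_ge0 ?exprn_ge0 // ltW.
rewrite le_eqVlt; apply/orP; left; apply/eqP.
rewrite expr_div_n [x ^+ k.+1]exprS; move: (k.+1`!%:R : R) => f; field.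
by rewrite !gt_eqF ?exprn_gt0.
Qed.

End Asymptotics.

(** * Choice of the threshold and combination of the bounds *)

Theorem theorem1 (R : realType) (d : nat) (c : R) (hd : (2 <= d)%N)
    (hc : 0 < c) :
  forall e : R, 0 < e -> exists N : nat, forall n m T : nat,
    (N <= n)%N -> prime n ->
    rounds_to (c * n%:R) m ->
    rounds_to ((1 + 2 * delta R n) * m%:R) T ->
    [/\ 1 - e <= Pr (@coupled_law R d n T)
                    (fun u => ~~ failed u && (m <= dh_balls u)%N),
        forall w : T.-tuple (step n), never_fails R d w ->
          Pr (@coupled_law R d n T) (fun u => places_as w u)
            = @mrh_law R d n T w
      & exists J : T.-tuple (cstep n) * m.-tuple (step n) -> R,
          is_coupling (@coupled_law R d n T) (@dh_law R d n m) J /\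
          1 - e <= Pr J (fun x =>
                     dominates (cfinal_state x.1) (final_state x.2))].
Proof.
move=> e e0.
(* [C] bounds [T / n], from [T <= 2 * m + 1] and [m <= c * n + 1]. *)
pose C : R := 2 * c + 3.
(* The constant of [failure_tail], doubled because [n.-1] is bounded below by [n / 2]. *)
pose D : R := 64 * d%:R ^+ 4.
have C0 : 0 < C by rewrite /C; lra.
have dR : 0 < d%:R :> R by rewrite ltr0n; lia.
have D0 : 0 < D by rewrite mulr_gt0 // exprn_gt0.
(* The union bound has order [n ^ 2] terms, and [n ^ 2 = x ^+ 10] when [x] is [n] to the power
   [0.2]. *)
have [K [K0 KP]] := poly_expRN_bound 10 C0 D0.
(* The summands serve, in order, the smallness of [delta] and of [nu / delta], the failure
   probability, and a shortage of double hashing balls. *)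
pose M : R := 6 + 2 * K / e + 12 / c * (2 / e + 2).
have a0 : 0 < 2 * K / e by rewrite !mulr_gt0 ?invr_gt0.
have b0 : 0 < 12 / c * (2 / e + 2).
  by rewrite !mulr_gt0 ?invr_gt0 // addr_gt0 // divr_gt0.
have [N0 N0P] := @powR_nat_eventually R M (1 / 100) ltac:(rewrite /M; lra) ltac:(lra).
exists (maxn d N0) => n m T; rewrite geq_max => /andP[dn /N0P nM] n_pr hm hT.
have n1 := prime_gt1 n_pr; have d0 : (0 < d)%N by apply: ltnW.
have nR1 : 1 <= n%:R :> R by rewrite ler1n ltnW.
have nz : n%:R != 0 :> R by rewrite gt_eqF // (lt_le_trans ltr01).
set dl := delta R n in hT *; have dl0 : 0 < dl := delta_gt0 R (ltnW n1).
have dl_inv : dl * n%:R `^ (1 / 100) = 1.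
  by rewrite -powRD ?nz ?implybT // addNr powRr0.
set x : R := n%:R `^ (2 / 10).
have xM : M <= x by apply: le_trans nM _; rewrite ler_powR //; lra.
have x0 : 0 < x by apply: lt_le_trans xM; rewrite /M; lra.
have dl6 : dl <= 1 / 6.
  rewrite -(ler_pM2r (_ : 0 < n%:R `^ (1 / 100))) ?dl_inv; last first.
    by apply: lt_le_trans nM; rewrite /M; lra.
  by move: nM; rewrite /M; lra.
have slack : 1 <= (1 + dl) * (1 - n%:R `^ (- (4 / 10))).
  set nu : R := _ `^ _.
  have nu0 : 0 < nu by apply: powR_gt0; apply: lt_le_trans nR1.
  have nuE : nu * n%:R `^ (39 / 100) = dl.
    by rewrite -powRD ?nz ?implybT // /dl /delta; congr powR; lra.
  have : 2 <= n%:R `^ (39 / 100) :> R.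
    apply: (@le_trans _ _ (n%:R `^ (1 / 100))); last by rewrite ler_powR //; lra.
    by move: nM; rewrite /M; lra.
  move: (n%:R `^ _) nuE => y nuE y2.
  (* Together with [nu * dl <= nu], the loss [nu + nu * dl] is at most the gain [dl]. *)
  have : nu * 2 <= dl by rewrite -nuE ler_pM2l.
  by have : nu * dl <= nu by [rewrite ger_pMr //; lra]; lra.
have /andP[m1 m2] := rounds_to_bounds hm.
have /andP[T1 T2] := rounds_to_bounds hT.
have dln : x <= dl * n%:R.
  rewrite -[X in _ * X]powRr1 // /dl /delta -powRD ?nz ?implybT //.
  by rewrite ler_powR //; lra.
pose beta : R := expR (- (x / D)).
have tail s r z := failure_tail d0 dn n_pr s r z slack.
have {}tail s r z :
    #|[set t : 'S_n | (1 + delta R n) * next_prob R d n (position s r z)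
       < eta R d (relabel t s) (t^-1 * r)%g (t z)]|%:R <= n`!%:R * beta.
  apply: le_trans (tail s r z) _; rewrite ler_wpM2l // ler_expR lerN2.
  have -> : x / D = x / 2 / (32 * d%:R ^+ 4) by rewrite /D; field; rewrite gt_eqF.
  rewrite ler_pM2r ?invr_gt0 ?mulr_gt0 ?exprn_gt0 //.
  have -> : x = (n%:R `^ (- (4 / 10))) ^+ 2 * n%:R.
    rewrite -powR_mulrn ?powR_ge0 // -powRrM -[X in _ * X]powRr1 // -powRD ?nz ?implybT //.
    by rewrite /x; congr powR; field.
  rewrite -mulrA ler_wpM2l ?sqr_ge0 //.
  have nR2 : 2 <= n%:R :> R by rewrite ler_nat.
  by rewrite -subn1 natrB ?(ltnW n1) //; lra.
have fail_le : T%:R * n%:R * beta <= e / 2.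
  have x10 : x ^+ 10 = n%:R ^+ 2.
    by rewrite -!powR_mulrn ?powR_ge0 // -powRrM; congr powR; field.
  have TC : T%:R <= C * n%:R.
    have : 2 * dl * m%:R <= m%:R by rewrite ler_piMl //; lra.
    by rewrite /C; lra.
  apply: (@le_trans _ _ (C * x ^+ 10 * beta)).
    by rewrite ler_wpM2r ?expR_ge0 // x10 expr2 mulrA ler_wpM2r.
  apply: le_trans (KP x x0) _.
  rewrite ler_pdivrMr //.
  have : 2 * K / e <= x by move: xM; rewrite /M; lra.
  by rewrite ler_pdivrMr //; lra.
have few_le : expR (1 - dl * m%:R / 12) <= e / 2.
  have dlm : c * x - 1 <= dl * m%:R.
    have : dl * (c * n%:R - 1) <= dl * m%:R by rewrite ler_pM2l.
    have : c * x <= c * (dl * n%:R) by rewrite ler_pM2l.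
    by lra.
  have y0 : 2 / e <= c * x / 12 - 2.
    have : 12 / c * (2 / e + 2) <= x by move: xM; rewrite /M; lra.
    by rewrite mulrAC ler_pdivrMr //; lra.
  set y := c * x / 12 - 2 in y0.
  have y0' : 0 < y by apply: lt_le_trans y0; rewrite divr_gt0.
  apply: (@le_trans _ _ (expR (- y))); first by rewrite ler_expR /y; lra.
  apply: le_trans (@expRN_le_pow R 0 y y0') _.
  rewrite expr1 ler_pdivrMr //.
  by move: y0; rewrite ler_pdivrMr // /factorial; lra.
have likely : 1 - e <= Pr (@coupled_law R d n T)
    (fun u : T.-tuple (cstep n) => ~~ failed u && (m <= dh_balls u)%N).
  have nf := coupled_not_failed d0 dn n1 T tail.
  have Tb : (1 + 2 * dl) * m%:R - 1 <= T%:R <= (1 + 2 * dl) * m%:R + 1 by rewrite T1.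
  have few := extra_balls_tail d0 dn n1 dl6 Tb.
  move: nf; rewrite /Pr (bigID (fun u : T.-tuple (cstep n) => (m <= dh_balls u)%N)) /=.
  rewrite [X in _ <= _ + X](_ : _ = Pr (@coupled_law R d n T)
    (fun u : T.-tuple (cstep n) => ~~ failed u && (dh_balls u < m)%N)); last first.
    by rewrite /Pr; apply: eq_bigl => u; rewrite -ltnNge.
  by move: few; move: (Pr _ _) (\sum_(u | _) _) => a b; lra.
split=> // [w|]; first exact: coupled_places_as.
exact: coupled_dominates.
Qed.
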